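(* Let $X, Y$ be finite dimensional Euclidean spaces, $A: X \to Y$ linear, $b \in Y$, $c \in X$, and $K \subseteq Y$ a nice closed convex cone. Consider the conic linear program $$(P)\qquad \sup\ \langle c, x\rangle \quad \text{s.t.}\quad b - Ax \in K,$$ assumed feasible, with minimal cone $F_{\min}$. Let $L = \{y \in Y : A^*y = 0,\ \langle b, y \rangle = 0\}$, let $\ell_K$ be the length of the longest chain of faces in $K$, and $\ell = \min\{\ell_K - 1, \dim L\}$. Let $(EXT_{\rm nice, simple})$ be the system in the variables $(u_i, v_i)_{i=0}^{\ell+1}$, $u_i,v_i \in Y$: $$(u_0,v_0) = (0,0),\quad (u_i, v_i) \in K^* \times \tan(u_{i-1}, K^* )\ (i = 1,\dots,\ell+1),\quad u_i + v_i \in L\ (i=1,\dots,\ell).$$ Then $$F_{\min}^* = \{\, u_{\ell+1} + v_{\ell+1} : (u_i,v_i)_{i=0}^{\ell+1} \text{ is feasible in } (EXT_{\rm nice, simple}) \,\},$$ and the extended dual $$\inf\ \langle b, u_{\ell+1}+v_{\ell+1}\rangle \quad \text{s.t.}\quad A^*(u_{\ell+1}+v_{\ell+1}) = c,\ (u_i,v_i)_{i=0}^{\ell+1} \text{ is feasible in } (EXT_{\rm nice, simple})$$ has strong duality with $(P)$. In particular, if $(P)$ is a semidefinite program with $m$ variables, independent constraint matrices $a_1,\dots,a_m$, and $K = \mathcal{S}^n_+$ (that is, $X = \mathbb{R}^m$, $Y = \mathcal{S}^n$, $Ax = \sum_{i=1}^m x_i a_i$ with $a_1, \dots, a_m \in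 \mathcal{S}^n$), then the problem $$\begin{array}{rll} \inf & \langle b, u_{\ell+1}+v_{\ell+1}\rangle & \\ \text{s.t.} & A^*(u_{\ell+1}+v_{\ell+1}) = c, & \\ & A^*(u_i+v_i) = 0,\ \langle b, u_i + v_i\rangle = 0, & i=1,\dots,\ell,\\ & u_i \succeq 0, & i=1,\dots,\ell+1,\\ & \begin{pmatrix} u_{i-1} & w_i \\ w_i^T & \beta_i I\end{pmatrix} \succeq 0, & i=1,\dots,\ell+1,\\ & v_i = w_i + w_i^T, & i=1,\dots,\ell+1,\\ & w_i \in \mathbb{R}^{n\times n},\ \beta_i \in \mathbb{R}, & i=1,\dots,\ell+1,\\ & (u_0,v_0) = (0,0), & \end{array}$$ where $\ell = \min\{ n,\ n(n+1)/2 - m - 1\}$, has strong duality with $(P)$.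
   Context: $\mathcal{S}^n$ is the space of $n\times n$ real symmetric matrices with inner product $\langle x, z\rangle = \sum_{i,j} x_{ij}z_{ij}$, $\mathcal{S}^n_+$ the cone of positive semidefinite ones, $y \succeq 0$ means $y$ is positive semidefinite. For a set $C$, $C^\perp$ is the orthogonal complement of its linear span. For a cone $C$, $C^* = \{ z : \langle z, x\rangle \ge 0 \ \forall x \in C\}$. $A^*$ is the adjoint of $A$. A convex subset $F$ of a convex set $C$ is a face of $C$ if $x_1, x_2 \in C$ and $(x_1,x_2)\cap F \ne \emptyset$ imply $x_1, x_2 \in F$, where $(x_1,x_2)$ is the open line segment. A closed convex cone $K$ is nice if $K^* + E^\perp$ is closed for all faces $E$ of $K$. For $x$ in a convex set $C$, $\operatorname{dir}(x,C) = \{ y : x + ty \in C \text{ for some } t>0\}$ and $\tan(x,C) = \operatorname{cl}\operatorname{dir}(x,C) \cap -\operatorname{cl}\operatorname{dir}(x,C)$. The minimal cone $F_{\min}$ of feasible $(P)$ is the unique face of $K$ that contains $b - A\bar{x}$ in its relative interior, where $\bar x$ is a point in the relative interior of the feasible set of $(P)$. The length of a chain of faces is the number of (nonempty) faces in a strictly increasing chain (e.g. $\ell_K = n+1$ for $\mathcal{S}^n_+$). A minimization problem $(D')$ has strong duality with the feasible problem $(P)$ if: $(P)$ is bounded if and only if $(D')$ is feasible; and when these equivalent conditions hold, the optimal values of $(P)$ and $(D')$ agree and the latter is attained.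
   Formalization: In the semidefinite part, when b lies in the span of a_1,…,a_m, ℓ is taken as min{n, n(n+1)/2 − m} (the true min{ℓ_K − 1, dim L}); the printed ℓ is then too small and the claim fails, e.g. n=m=2, a=(E22, E12+E21), b=0, c=(0,1). *)

(* Defs.v *)
From HB Require Import structures.
From mathcomp Require Import all_boot all_order all_algebra.
From mathcomp Require Import boolp classical_sets reals constructive_ereal ereal.
From mathcomp Require Import convex.

Set Implicit Arguments.
Unset Strict Implicit.
Unset Printing Implicit Defensive.

Import Order.TTheory GRing.Theory Num.Theory.

Local Open Scope classical_set_scope.
Local Open Scope ring_scope.

(* A finite dimensional Euclidean space is a [vectType R] together with an
   inner product [ip : {dot Y for idfun}] (over a real field, a symmetric
   positive definite bilinear form).  A [vectType] carries no topology, so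
   closure and relative interior are taken for the norm induced by [ip]. *)

Section Euclidean.
Context (R : realType) (Y : vectType R) (ip : {dot Y for idfun}).
Implicit Types (C D E F K : set Y) (x y z u v : Y).

Definition eucl_norm x : R := Num.sqrt (ip x x).

Definition eucl_closure C : set Y :=
  [set x | forall e : R, 0 < e -> exists2 y, C y & eucl_norm (y - x) < e].

Definition eucl_closed C : Prop := eucl_closure C `<=` C.

Definition lin_span C : set Y :=
  [set x | exists2 s : seq Y, {in s, forall y, C y} & x \in <<s>>%VS].

Definition orth C : set Y := [set y | forall x, lin_span C x -> ip y x = 0].

Definition aff_hull C : set Y :=
  [set x | exists (k : nat) (p : 'I_k -> Y) (t : 'I_k -> R),
    [/\ forall i, C (p i), \sum_i t i = 1 & x = \sum_i t i *: p i]].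

Definition relint C : set Y :=
  [set x | C x /\ exists2 e : R, 0 < e &
    forall y, aff_hull C y -> eucl_norm (y - x) < e -> C y].

Definition convex C : Prop := convex_set (C : set (convex_lmodType Y)).

Definition is_cone C : Prop := forall (t : R) x, 0 <= t -> C x -> C (t *: x).

Definition closed_convex_cone K : Prop :=
  [/\ eucl_closed K, convex K & is_cone K].

Definition dual_cone C : set Y := [set z | forall x, C x -> 0 <= ip z x].

Definition open_segment x y : set Y :=
  [set t *: x + (1 - t) *: y | t in [set t : R | 0 < t < 1]].

Definition face F C : Prop :=
  [/\ F `<=` C, convex F &
    forall x1 x2, C x1 -> C x2 ->
      open_segment x1 x2 `&` F !=set0 -> F x1 /\ F x2].

Definition nice K : Prop :=
  closed_convex_cone K /\
  forall E, face E K ->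
    eucl_closed [set y + z | y in dual_cone K & z in orth E].

Definition dir x C : set Y := [set y | exists2 t : R, 0 < t & C (x + t *: y)].

Definition tan x C : set Y :=
  eucl_closure (dir x C) `&` [set y | eucl_closure (dir x C) (- y)].

Definition face_chain K (l : nat) : Prop :=
  exists E : nat -> set Y,
    (forall i, (i < l)%N -> face (E i) K /\ E i !=set0) /\
    (forall i, (i.+1 < l)%N -> E i `<` E i.+1).

Definition longest_face_chain K (l : nat) : Prop :=
  face_chain K l /\ forall k, face_chain K k -> (k <= l)%N.

End Euclidean.

Section ConicLP.
Context (R : realType) (X Y : vectType R).
Context (ipX : {dot X for idfun}) (ipY : {dot Y for idfun}).
Implicit Types (A : 'Hom(X, Y)) (As : 'Hom(Y, X)) (b : Y) (c : X).
Implicit Types (K F : set Y).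

Definition is_adjoint A As : Prop :=
  forall x y, ipY (A x) y = ipX x (As y).

Definition primal_feasible A b K : set X := [set x | K (b - A x)].

Definition primal_values A b c K : set R :=
  [set ipX c x | x in primal_feasible A b K].

Definition minimal_cone A b K F : Prop :=
  face F K /\
  exists2 xbar, relint ipX (primal_feasible A b K) xbar &
    relint ipY F (b - A xbar).

(* [As] is meant to be the adjoint of [A]. *)
Definition Lspace As b : {vspace Y} := (lker As :&: orthov ipY <[b]>)%VS.

(* Finite families (u_i, v_i), 0 <= i <= ell + 1, are given by functions on
   [nat] whose values at the other indices are irrelevant. *)
Definition ext_nice_simple K (L : {vspace Y}) (ell : nat) (u v : nat -> Y)
    : Prop :=
  [/\ u 0%N = 0 /\ v 0%N = 0,
      forall i, (1 <= i <= ell.+1)%N ->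
        dual_cone ipY K (u i) /\ tan ipY (u i.-1) (dual_cone ipY K) (v i) &
      forall i, (1 <= i <= ell)%N -> u i + v i \in L].

Definition ext_dual_values As b c K (L : {vspace Y}) (ell : nat) : set R :=
  [set d | exists u v : nat -> Y,
    [/\ As (u ell.+1 + v ell.+1) = c,
        ext_nice_simple K L ell u v &
        d = ipY b (u ell.+1 + v ell.+1)]].

End ConicLP.

(* [P] is the set of objective values of a feasible maximization problem at
   its feasible points, [D] that of a minimization problem; the latter problem
   is feasible iff [D] is nonempty, and its optimal value is attained iff that
   value belongs to [D]. *)
Definition strong_duality (R : realType) (P D : set R) : Prop :=
  let valP := ereal_sup [set p%:E | p in P] in
  let valD := ereal_inf [set d%:E | d in D] in
  ((valP < +oo)%E <-> D !=set0) /\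
  ((valP < +oo)%E -> valP = valD /\ exists2 d, D d & d%:E = valD).

Section SDP.
Context (R : realType) (n : nat).
Implicit Types (x y z b : 'M[R]_n).

Definition mxip x z : R := \sum_i \sum_j x i j * z i j.

Definition psdmx (k : nat) (y : 'M[R]_k) : Prop :=
  y^T = y /\ forall h : 'cV[R]_k, 0 <= (h^T *m y *m h) 0 0.

Context (m : nat) (a : m.-tuple 'M[R]_n).

Definition sdp_map (x : 'rV[R]_m) : 'M[R]_n := \sum_i x 0 i *: tnth a i.

(* The adjoint of [sdp_map] for the standard inner product of R^m. *)
Definition sdp_adj (y : 'M[R]_n) : 'rV[R]_m := \row_i mxip (tnth a i) y.

Definition sdp_feasible b : set 'rV[R]_m := [set x | psdmx (b - sdp_map x)].

Definition sdp_primal_values b (c : 'rV[R]_m) : set R :=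
  [set \sum_i c 0 i * x 0 i | x in sdp_feasible b].

(* For linearly independent [a] this is min{n, dim L}, where
   L = {y symmetric : sdp_adj y = 0, <b, y> = 0}.  If b is outside the span of
   [a] then dim L = n(n+1)/2 - m - 1; if b is in the span, the condition
   <b, y> = 0 is redundant and dim L = n(n+1)/2 - m.  The value
   min{n, n(n+1)/2 - m - 1} is too small in the latter case: for n = m = 2,
   a = (E22, E12 + E21), b = 0, c = (0, 1) it is 0, and then the dual is
   infeasible although the primal value is 0. *)
Definition sdp_length b : nat :=
  if b \in <<a>>%VS then minn n ((n * n.+1)./2 - m)
  else minn n ((n * n.+1)./2 - m - 1).

Definition sdp_ext_feasible b (c : 'rV[R]_m) (ell : nat)
    (u v w : nat -> 'M[R]_n) (beta : nat -> R) : Prop :=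
  [/\ sdp_adj (u ell.+1 + v ell.+1) = c,
      forall i, (1 <= i <= ell)%N ->
        sdp_adj (u i + v i) = 0 /\ mxip b (u i + v i) = 0,
      forall i, (1 <= i <= ell.+1)%N -> psdmx (u i),
      forall i, (1 <= i <= ell.+1)%N ->
        psdmx (block_mx (u i.-1) (w i) (w i)^T (beta i)%:M) /\
        v i = w i + (w i)^T &
      u 0%N = 0 /\ v 0%N = 0].

Definition sdp_ext_dual_values b (c : 'rV[R]_m) (ell : nat) : set R :=
  [set d | exists (u v w : nat -> 'M[R]_n) (beta : nat -> R),
    sdp_ext_feasible b c ell u v w beta /\
    d = mxip b (u ell.+1 + v ell.+1)].

End SDP.

(* Main.v *)
From HB Require Import structures.
Require Import Defs.
From mathcomp Require Import all_boot all_order all_algebra.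
From mathcomp Require Import boolp classical_sets reals constructive_ereal ereal.
From mathcomp Require Import interval_inference convex lra ring zify.

(* Facial reduction.  Let E = K ∩ u^⊥ be an exposed face of K containing all
   the slacks b - Ax.  If some y in L is nonnegative but not identically zero
   on E, then y cuts E down to a smaller such face.  Let D be the dual cone of K;
   niceness of K allows to write y = p + q with p in D and q in
   E^⊥ = tan(u, D), so that the new face is K ∩ (u + p)^⊥ and the partial sums
   of the p's and of the q's solve the extended system.  The faces decrease
   strictly and the vectors y are linearly independent, so the process stops
   after ell steps.  If no such y exists, then by proper separation the slacks
   meet the relative interior of E, hence E = F_min, whose dual cone is
   D + tan(u, D), and strong duality over E holds by a second proper separation.

   For semidefinite programs the same argument is run in the space of all
   matrices, with dual variables restricted to the symmetric ones.  Niceness is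
   replaced by an explicit splitting: if Q projects onto ker u and P = I - Q, then
   y = QyQ + (w + w^T) with w = Py - PyP/2 of the form ug, which is exactly the
   condition for [u, w; w^T, beta I] to be psd for large beta. *)

Set Implicit Arguments.
Unset Strict Implicit.
Unset Printing Implicit Defensive.

Import Order.TTheory GRing.Theory Num.Theory.

Local Open Scope classical_set_scope.
Local Open Scope ring_scope.

(** * Euclidean spaces *)

Section RealLemmas.
Context (R : realType).

(** Division by [t] and the limit at 0, made explicit; this is the first-order condition at the
    minimum of a quadratic function. *)
Lemma ge0_of_quadratic (p q : R) :
  (forall t, 0 < t <= 1 -> 0 <= t * p + t ^+ 2 * q) -> 0 <= p.
Proof.
move=> H; rewrite leNgt; apply/negP => p_lt0.
have d_gt0 : 0 < `|q| - p by have := normr_ge0 q; lra.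
(* With this [t] the value [p + t * q] is at most [p / 2 + t * p], which is negative. *)
set t := - p / (`|q| - p) / 2.
have t_gt0 : 0 < t by rewrite !divr_gt0 ?oppr_gt0.
have t_le1 : t <= 1.
  by rewrite !ler_pdivrMr // mul1r; have := normr_ge0 q; lra.
have tE : t * (`|q| - p) = - p / 2 by rewrite /t; field; lra.
have le_tq : t * q <= t * `|q| by rewrite ler_pM2l ?ler_norm.
have tp_lt0 : t * p < 0 by rewrite pmulr_rlt0.
have := H t; rewrite t_gt0 t_le1 expr2 -mulrA -mulrDr pmulr_rge0 // => /(_ isT).
by move: tE; rewrite mulrBr; lra.
Qed.

Lemma exists_between (I : Type) (i0 : I) (f g : I -> R) :
  (forall i j, f i <= g j) -> exists l, forall i, f i <= l <= g i.
Proof.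
move=> fg; exists (sup (range f)) => i.
have f_ub j : ubound (range f) (g j) by move=> _ [k _ <-].
apply/andP; split; last by apply: ge_sup => //; exists (f i0), i0.
by apply: ub_le_sup; [exists (g i); exact: f_ub | exists i].
Qed.

End RealLemmas.

Section InnerProduct.
Context (R : realType) (Y : vectType R) (ip : {dot Y for idfun}).
Implicit Types (C D E F K : set Y) (x y z u v : Y) (t : R).

Lemma ipC x y : ip x y = ip y x.
Proof. by rewrite hermC /= expr0 mul1r. Qed.

(* The library's bilinearity lemmas, restated because they leave the form
   coerced to [Bilinear.type], where the lemmas below do not rewrite. *)
Lemma ipDl x y z : ip (x + y) z = ip x z + ip y z. Proof. exact: linearDl. Qed.
Lemma ipDr x y z : ip x (y + z) = ip x y + ip x z. Proof. exact: linearDr. Qed.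
Lemma ipNl x y : ip (- x) y = - ip x y. Proof. exact: linearNl. Qed.
Lemma ipNr x y : ip x (- y) = - ip x y. Proof. exact: linearNr. Qed.
Lemma ip0l x : ip 0 x = 0. Proof. exact: linear0l. Qed.
Lemma ip0r x : ip x 0 = 0. Proof. exact: linear0r. Qed.
Lemma ipZl t x y : ip (t *: x) y = t * ip x y. Proof. exact: linearZl_LR. Qed.
Lemma ipZr t x y : ip x (t *: y) = t * ip x y. Proof. exact: linearZr_LR. Qed.

Lemma ip_suml (I : Type) (r : seq I) (P : pred I) (f : I -> Y) y :
  ip (\sum_(i <- r | P i) f i) y = \sum_(i <- r | P i) ip (f i) y.
Proof. by elim/big_rec2: _ => [|i s z _ <-]; rewrite ?ip0l ?ipDl. Qed.

Lemma ip_sumr (I : Type) (r : seq I) (P : pred I) (f : I -> Y) y :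
  ip y (\sum_(i <- r | P i) f i) = \sum_(i <- r | P i) ip y (f i).
Proof. exact: linear_sumr. Qed.

Definition ipE := (ipDl, ipDr, ipNl, ipNr, ip0l, ip0r, ipZl, ipZr).

Lemma ip_gt0 x : x != 0 -> 0 < ip x x.
Proof. exact: neq0_dnorm_gt0. Qed.

Lemma ip_ge0 x : 0 <= ip x x.
Proof.
by have [->|/ip_gt0/ltW//] := eqVneq x 0; rewrite ip0r.
Qed.

Lemma ip_eq0 x : ip x x = 0 -> x = 0.
Proof. by apply: contra_eq => /ip_gt0; case: ltgtP. Qed.

Lemma ip_sqrD x y : ip (x + y) (x + y) = ip x x + 2 * ip x y + ip y y.
Proof. by rewrite !ipE (ipC y x); ring. Qed.

Lemma cauchy_schwarz x y : ip x y ^+ 2 <= ip x x * ip y y.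
Proof.
have [->|/ip_gt0 y_gt0] := eqVneq y 0; first by rewrite !ip0r expr0n mulr0.
have := ip_ge0 (ip y y *: x - ip x y *: y).
rewrite !ipE (ipC y x) => H.
suff : 0 <= ip y y * (ip x x * ip y y - ip x y ^+ 2).
  by rewrite pmulr_rge0 // subr_ge0.
by move: H; congr (_ <= _); ring.
Qed.

Lemma eucl_norm_sqr x : eucl_norm ip x ^+ 2 = ip x x.
Proof. by rewrite sqr_sqrtr ?ip_ge0. Qed.

Lemma eucl_norm_ge0 x : 0 <= eucl_norm ip x.
Proof. exact: sqrtr_ge0. Qed.

Lemma eucl_norm_gt0 x : x != 0 -> 0 < eucl_norm ip x.
Proof. by move=> x0; rewrite sqrtr_gt0 ip_gt0. Qed.

Lemma ip_le_norm x y : `|ip x y| <= eucl_norm ip x * eucl_norm ip y.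
Proof.
rewrite -(@ler_pXn2r _ 2) ?nnegrE ?mulr_ge0 ?eucl_norm_ge0 //.
by rewrite exprMn !eucl_norm_sqr real_normK ?num_real ?cauchy_schwarz.
Qed.

Lemma eucl_normD x y :
  eucl_norm ip (x + y) <= eucl_norm ip x + eucl_norm ip y.
Proof.
rewrite -(@ler_pXn2r _ 2) ?nnegrE ?addr_ge0 ?eucl_norm_ge0 //.
rewrite eucl_norm_sqr ip_sqrD sqrrD !eucl_norm_sqr -mulr_natl.
have := ip_le_norm x y; have := ler_norm (ip x y); lra.
Qed.

Lemma eucl_normZ t x : eucl_norm ip (t *: x) = `|t| * eucl_norm ip x.
Proof.
by rewrite /eucl_norm !ipE mulrA -expr2 sqrtrM ?sqr_ge0 // sqrtr_sqr.
Qed.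

Lemma eucl_normN x : eucl_norm ip (- x) = eucl_norm ip x.
Proof. by rewrite /eucl_norm ipNl ipNr opprK. Qed.

Lemma eucl_norm0 : eucl_norm ip 0 = 0.
Proof. by rewrite /eucl_norm ip0r sqrtr0. Qed.

Lemma eucl_norm_sum (I : Type) (r : seq I) (f : I -> Y) :
  eucl_norm ip (\sum_(i <- r) f i) <= \sum_(i <- r) eucl_norm ip (f i).
Proof.
elim/big_ind2: _ => [|x t y s le1 le2|//]; first by rewrite eucl_norm0.
exact: le_trans (eucl_normD _ _) (lerD le1 le2).
Qed.

(* Gram-Schmidt; the lists [s] are orthonormal, but only Parseval's identity
   is ever needed. *)
Lemma parseval_span (X : seq Y) : exists2 s : seq Y,
  {subset s <= <<X>>%VS} & {in <<X>>%VS, forall y, y = \sum_(e <- s) ip e y *: e}.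
Proof.
elim: X => [|x X [s sX sP]].
  by exists [::] => // y; rewrite span_nil memv0 big_nil => /eqP.
pose P y := \sum_(e <- s) ip e y *: e.
have PX y : P y \in <<X>>%VS.
  by rewrite /P big_seq memv_suml // => e es; rewrite memvZ ?sX.
have P_orth y z : z \in <<X>>%VS -> ip z (y - P y) = 0.
  move=> zX; rewrite ipDr ipNr {1}(sP _ zX) ip_suml ip_sumr.
  apply/eqP; rewrite subr_eq0; apply/eqP/eq_bigr => e _.
  by rewrite ipZl ipZr (ipC z) mulrC.
have sub_x z : z \in <<X>>%VS -> z \in <<x :: X>>%VS.
  by apply: subvP; rewrite span_cons addvSr.
have [x'0|x'_neq0] := eqVneq (x - P x) 0.
  have xX : x \in <<X>>%VS by rewrite (subr0_eq x'0).
  exists s => [e /sX/sub_x //|y]; rewrite span_cons => /memv_addP[].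
  by move=> _ /vlineP[k ->] [z zX ->]; apply: sP; rewrite memvD ?memvZ.
set x' := x - P x in x'_neq0; pose e := (eucl_norm ip x')^-1 *: x'.
have x'_orth z : z \in <<X>>%VS -> ip z x' = 0 by exact: P_orth.
exists (e :: s) => [f|y].
  rewrite inE => /predU1P[->|/sX/sub_x //].
  by rewrite memvZ // memvB ?(sub_x (P x)) // memv_span ?mem_head.
rewrite span_cons => /memv_addP[_ /vlineP[k ->] [w wX ->]].
set y' := k *: P x + w.
have y'X : y' \in <<X>>%VS by rewrite memvD ?memvZ.
have -> : k *: x + w = k *: x' + y'.
  by rewrite /y' addrA -scalerDr /x' subrK.
clearbody y'; rewrite big_cons; congr (_ + _).
  rewrite /e ipDr !ipZl (ipC x' y') x'_orth // mulr0 addr0 ipZr.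
  rewrite scalerA -eucl_norm_sqr; congr (_ *: _).
  have n_neq0 : eucl_norm ip x' != 0 by rewrite gt_eqF ?eucl_norm_gt0.
  by field.
rewrite {1}(sP _ y'X) big_seq [RHS]big_seq; apply: eq_bigr => f fs.
by rewrite ipDr ipZr x'_orth ?sX // mulr0 add0r.
Qed.

Lemma parseval : exists s : seq Y, forall y, y = \sum_(e <- s) ip e y *: e.
Proof.
have [s _ sP] := parseval_span (vbasis {:Y}).
by exists s => y; apply: sP; rewrite (span_basis (vbasisP _)) memvf.
Qed.

(** Used for coordinates along a basis, to turn closeness in norm into closeness of coordinates. *)
Lemma linear_bounded (f : {scalar Y}) :
  exists2 B, 0 <= B & forall y, `|f y| <= B * eucl_norm ip y.
Proof.
have [s sP] := parseval.
exists (\sum_(e <- s) eucl_norm ip e * `|f e|) => [|y].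
  by apply: sumr_ge0 => e _; rewrite mulr_ge0 ?eucl_norm_ge0.
rewrite {1}(sP y) linear_sum mulr_suml (le_trans (ler_norm_sum _ _ _)) //.
apply: ler_sum => e _; rewrite linearZ /= normrM mulrAC.
by rewrite ler_wpM2r ?ip_le_norm.
Qed.

(** Completeness for families indexed by their precision. For each [e] of a Parseval family, the
    intervals of radius [|e| d] around [ip e (y d)] meet pairwise, so [exists_between] gives a
    common point, the coordinate of the limit. *)
Lemma eucl_complete (y : R -> Y) :
  (forall d e, 0 < d -> 0 < e -> eucl_norm ip (y d - y e) <= d + e) ->
  exists l B, forall d, 0 < d -> eucl_norm ip (y d - l) <= B * d.
Proof.
move=> y_cauchy; have [s sP] := parseval.
have /choice[c cP] e : exists c, forall d, 0 < d ->
    `|ip e (y d) - c| <= eucl_norm ip e * d.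
  have [] := @exists_between R {d : R | 0 < d} (exist _ 1 ltr01)
    (fun d => ip e (y (sval d)) - eucl_norm ip e * sval d)
    (fun d => ip e (y (sval d)) + eucl_norm ip e * sval d).
    move=> [d d0] [d' d'0] /=; rewrite lerBlDr -addrA addrC -lerBlDr.
    rewrite -ipNr -ipDr -mulrDr.
    apply: le_trans (ler_norm _) (le_trans (ip_le_norm _ _) _).
    by rewrite ler_wpM2l ?eucl_norm_ge0 // [d' + d]addrC y_cauchy.
  move=> c cP; exists c => d d0; have /= := cP (exist _ d d0).
  by rewrite ler_distl => /andP[? ?]; apply/andP; split; lra.
exists (\sum_(e <- s) c e *: e).
exists (\sum_(e <- s) eucl_norm ip e * eucl_norm ip e) => d d0.
rewrite {1}(sP (y d)) -sumrB mulr_suml (le_trans (eucl_norm_sum _ _)) //.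
apply: ler_sum => e _; rewrite -scalerBl eucl_normZ mulrAC.
by rewrite ler_wpM2r ?eucl_norm_ge0 ?cP.
Qed.

End InnerProduct.

(** * Convex cones and separation *)

Section Cones.
Context (R : realType) (Y : vectType R) (ip : {dot Y for idfun}).
Implicit Types (C D E F K : set Y) (x y z u v : Y) (t : R).

Definition convex_cone C : Prop :=
  [/\ C 0, forall x y, C x -> C y -> C (x + y)
    & forall t x, 0 <= t -> C x -> C (t *: x)].

Lemma convex_comb C t x y :
  convex C -> 0 <= t <= 1 -> C x -> C y -> C (t *: x + (1 - t) *: y).
Proof.
move=> cC /andP[t0 t1] Cx Cy.
have := cC x y (Itv01 t0 t1); rewrite !inE => /(_ Cx Cy).
by rewrite /conv /=.
Qed.

Lemma convex_cone_of_convex C :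
  convex C -> is_cone C -> C !=set0 -> convex_cone C.
Proof.
move=> cC hC [x0 Cx0]; split=> // [|x y Cx Cy].
  by rewrite -(scale0r x0); apply: hC.
have -> : x + y = 2 *: (2^-1 *: x + (1 - 2^-1) *: y).
  rewrite scalerDr !scalerA; congr (_ + _); rewrite -[LHS]scale1r; congr (_ *: _); lra.
by apply: hC => //; apply: convex_comb => //; lra.
Qed.

Lemma convex_cone_convex C : convex_cone C -> convex C.
Proof.
move=> [_ CD CZ] x y t; rewrite !inE => Cx Cy.
by apply: CD; apply: CZ => //=; rewrite subr_ge0.
Qed.

Lemma convex_cone_sum C (I : Type) (r : seq I) (P : pred I) (f : I -> Y) :
  convex_cone C -> (forall i, P i -> C (f i)) -> C (\sum_(i <- r | P i) f i).
Proof. by move=> [C0 CD _] Cf; elim/big_ind: _. Qed.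

Lemma sub_eucl_closure C : C `<=` eucl_closure ip C.
Proof. by move=> x Cx e e0; exists x; rewrite // subrr eucl_norm0. Qed.

Lemma eucl_closure_closed C : eucl_closed ip (eucl_closure ip C).
Proof.
move=> x clx e e0; have e2 : 0 < e / 2 by rewrite divr_gt0.
have [y cly yx] := clx _ e2; have [z Cz zy] := cly _ e2.
exists z => //; rewrite -(subrK y z) -addrA.
by apply: le_lt_trans (eucl_normD _ _ _) _; lra.
Qed.

Lemma convex_cone_closure C : convex_cone C -> convex_cone (eucl_closure ip C).
Proof.
move=> [C0 CD CZ]; split; first exact: sub_eucl_closure.
  move=> x y clx cly e e0; have e2 : 0 < e / 2 by rewrite divr_gt0.
  have [x' Cx' x'x] := clx _ e2; have [y' Cy' y'y] := cly _ e2.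
  exists (x' + y'); first exact: CD.
  rewrite opprD addrACA; apply: le_lt_trans (eucl_normD _ _ _) _; lra.
move=> t x t0 clx e e0.
have et : 0 < e / (t + 1) by rewrite divr_gt0 // ltr_wpDl.
have [y Cy yx] := clx _ et; exists (t *: y); first exact: CZ.
rewrite -scalerBr eucl_normZ ger0_norm //.
have [n0|n_neq0] := eqVneq (eucl_norm ip (y - x)) 0; first by rewrite n0 mulr0.
have n0 : 0 < eucl_norm ip (y - x) by rewrite lt_def n_neq0 eucl_norm_ge0.
by move: yx; rewrite ltr_pdivlMr ?ltr_wpDl //; nra.
Qed.

(** A minimizing family is Cauchy by the parallelogram law, since midpoints stay in [K]; its limit
    is the minimizer. *)
Lemma nearest_point K x : eucl_closed ip K -> convex K -> K !=set0 ->
  exists2 y, K y & forall z, K z -> ip (y - x) (y - x) <= ip (z - x) (z - x).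
Proof.
move=> Kcl Kcv [k0 Kk0].
pose Q := [set ip (y - x) (y - x) | y in K]; pose D := inf Q.
have Q_lb : has_lbound Q by exists 0 => _ [y _ <-]; exact: ip_ge0.
have Dle y : K y -> D <= ip (y - x) (y - x).
  by move=> Ky; apply: ge_inf => //; exists y.
have D_ge0 : 0 <= D.
  apply: lb_le_inf; first by exists (ip (k0 - x) (k0 - x)), k0.
  by move=> _ [y _ <-]; exact: ip_ge0.
(* The slack [d ^+ 2 / 2] makes the squared distance of [y d] and [y e] at most [d ^+ 2 + e ^+ 2],
   hence at most the square of [d + e]. *)
have /choice[y yP] d : exists y, 0 < d -> K y /\ ip (y - x) (y - x) < D + d ^+ 2 / 2.
  have [d0|_] := ltP 0 d; last by exists 0.
  have [] := @inf_adherent _ Q (d ^+ 2 / 2); first by rewrite divr_gt0 ?exprn_gt0.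
    by split=> //; exists (ip (k0 - x) (k0 - x)), k0.
  by move=> _ [z Kz <-] ?; exists z.
have [l [B lP]] : exists l B, forall d, 0 < d -> eucl_norm ip (y d - l) <= B * d.
  apply: eucl_complete => d e d0 e0.
  have [Kd yd] := yP d d0; have [Ke ye] := yP e e0.
  rewrite -(@ler_pXn2r _ 2) ?nnegrE ?eucl_norm_ge0 ?addr_ge0 ?ltW //.
  rewrite eucl_norm_sqr.
  have Km : K (2^-1 *: y d + (1 - 2^-1) *: y e) by apply: convex_comb => //; lra.
  have := Dle _ Km.
  have -> : 2^-1 *: y d + (1 - 2^-1) *: y e - x
          = 2^-1 *: ((y d - x) + (y e - x)).
    have -> : 1 - 2^-1 = 2^-1 :> R by lra.
    rewrite -scalerDr [in RHS]addrACA -opprD [in RHS]scalerBr; congr (_ - _).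
    by rewrite -mulr2n -scaler_nat scalerA mulVf ?scale1r // pnatr_eq0.
  have -> : y d - y e = (y d - x) - (y e - x) by rewrite opprB addrA subrK.
  move: yd ye; move: (y d - x) (y e - x) => p q.
  by rewrite !ipE (ipC ip q p); nra.
have B_ge0 : 0 <= B.
  by have := lP 1 ltr01; rewrite mulr1; apply: le_trans (eucl_norm_ge0 _ _).
have Kl : K l.
  apply: Kcl => e e0; have d0 : 0 < e / (B + 1) by rewrite divr_gt0 ?ltr_wpDl.
  exists (y (e / (B + 1))); first by have [] := yP _ d0.
  apply: le_lt_trans (lP _ d0) _; rewrite mulrA ltr_pdivrMr ?ltr_wpDl //; nra.
exists l => // z Kz; apply: le_trans (Dle z Kz).
suff nD : eucl_norm ip (l - x) <= Num.sqrt D.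
  rewrite -eucl_norm_sqr -(sqr_sqrtr D_ge0).
  by rewrite ler_pXn2r ?nnegrE ?eucl_norm_ge0 ?sqrtr_ge0.
(* With [d = e / (B + 1)], the error [B * d] of the limit and the excess [d] of [y d] over the
   minimal distance add up to [e]. *)
apply/ler_addgt0Pl => e e0.
have d0 : 0 < e / (B + 1) by rewrite divr_gt0 ?ltr_wpDl.
set d := e / (B + 1) in d0; have [Kd yd] := yP _ d0.
have dE : d * (B + 1) = e by rewrite divfK // gt_eqF ?ltr_wpDl.
have -> : l - x = - (y d - l) + (y d - x) by rewrite opprB addrA subrK.
apply: le_trans (eucl_normD _ _ _) _; rewrite eucl_normN.
suff : eucl_norm ip (y d - x) <= Num.sqrt D + d by have := lP _ d0; lra.
rewrite -(@ler_pXn2r _ 2) ?nnegrE ?eucl_norm_ge0 ?addr_ge0 ?sqrtr_ge0 ?(ltW d0) //.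
rewrite eucl_norm_sqr sqrrD sqr_sqrtr //; apply: ltW; apply: lt_le_trans yd _.
have := mulr_ge0 (sqrtr_ge0 D) (ltW d0); have := sqr_ge0 d; lra.
Qed.

(** Take [z = y - x] with [y] nearest to [x]. Moving from [y] along [k] in [K] gives [ip z k >= 0],
    shrinking [y] gives [ip z y <= 0], and [x = y - z]. *)
Lemma separation K x : eucl_closed ip K -> convex_cone K -> ~ K x ->
  exists2 z, dual_cone ip K z & ip z x < 0.
Proof.
move=> Kcl Kcc NKx; have [K0 KD KZ] := Kcc.
have [|y Ky ymin] := nearest_point x Kcl (convex_cone_convex Kcc); first by exists 0.
have [z zE] : {z | z = y - x} by exists (y - x).
have zx : z != 0 by rewrite zE; apply: contra_notN NKx => /eqP/subr0_eq<-.
have grow t k : K (y + t *: k) -> 0 <= t * (2 * ip z k) + t ^+ 2 * ip k k.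
  move=> /ymin; rewrite addrAC -zE [leRHS]ip_sqrD !ipE; lra.
have zy : ip z y <= 0.
  suff : 0 <= - (2 * ip z y) by lra.
  apply: (@ge0_of_quadratic _ _ (ip y y)) => t t01.
  have := grow (- t) y; rewrite sqrrN mulNr mulrN; apply.
  by rewrite -[y in y + _]scale1r -scalerDl; apply: KZ => //; lra.
exists z => [k Kk|].
  suff : 0 <= 2 * ip z k by lra.
  apply: (@ge0_of_quadratic _ _ (ip k k)) => t /andP[t0 _].
  by apply: grow; apply/KD/KZ => //; exact: ltW.
have -> : x = y - z by rewrite zE subKr.
by have := ip_gt0 ip zx; rewrite !ipE; lra.
Qed.

Lemma dual_convex_cone C : convex_cone (dual_cone ip C).
Proof.
split=> [x _|x y Cx Cy z Cz|t x t0 Cx z Cz]; rewrite ?ipE //.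
  by rewrite addr_ge0 ?Cx ?Cy.
by rewrite mulr_ge0 ?Cx.
Qed.

Lemma bipolar K x : eucl_closed ip K -> convex_cone K ->
  dual_cone ip (dual_cone ip K) x -> K x.
Proof.
move=> Kcl Kcc xP; apply: contrapT => /(separation Kcl Kcc)[z /xP].
by rewrite ipC leNgt => /negbTE ->.
Qed.

Lemma orthP C x : orth ip C x <-> forall y, C y -> ip x y = 0.
Proof.
split=> [xC y Cy|xC y [s sC]].
  apply: xC; exists [:: y] => [z|]; last by rewrite memv_span ?mem_head.
  by rewrite inE => /eqP ->.
move=> /(@coord_span _ _ _ (in_tuple s)) ->; rewrite ip_sumr big1 // => i _.
by rewrite ipZr xC ?mulr0 //; apply: sC; exact: mem_nth.
Qed.

(** A free family in [C] of maximal length: a vector of [C] outside its span would extend it. *)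
Lemma cone_basis C : exists s : seq Y,
  [/\ free s, {in s, forall y, C y} & forall y, C y -> y \in <<s>>%VS].
Proof.
pose P k := `[< exists s : seq Y, [/\ free s, {in s, forall y, C y} & size s = k] >].
have P0 : exists k, P k.
  by exists 0%N; apply/asboolP; exists [::]; split=> //; exact: nil_free.
have Pub k : P k -> (k <= \dim {:Y})%N.
  move=> /asboolP[s [/eqnP <- _ <-]]; exact/dimvS/subvf.
case: (ex_maxnP P0 Pub) => k /asboolP[s [fs sC sk]] kmax.
exists s; split=> // y Cy; apply: contraT => ys.
have : P k.+1.
  apply/asboolP; exists (y :: s); rewrite free_cons ys fs /= sk; split=> // z.
  by rewrite inE => /predU1P[->|/sC].
by move=> /kmax; rewrite ltnn.
Qed.

(* Proper separation from the origin. If [-e], where [e] is the sum of a basis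
   of [span C] lying in [C], were in the closure of [C], then [C] would contain
   a combination of the basis with negative coefficients only, hence all of
   [span C]. *)
Lemma cone_opp C : convex_cone C -> dual_cone ip C `<=` orth ip C ->
  forall x, C x -> C (- x).
Proof.
move=> Ccc dualC; have [C0 CD CZ] := Ccc.
have [s [fs sC spanC]] := cone_basis C.
pose b := in_tuple s; pose e := \sum_(i < size s) b`_i.
have bC (i : 'I_(size s)) : C b`_i by apply: sC; exact: mem_nth.
have clNe : eucl_closure ip C (- e).
  apply: contrapT => /(separation (@eucl_closure_closed C) (convex_cone_closure Ccc)).
  move=> [z zC]; have /dualC/orthP zorth : dual_cone ip C z.
    by move=> c Cc; apply: zC; exact: sub_eucl_closure.
  by rewrite ipNr zorth ?oppr0 ?ltxx //; apply: convex_cone_sum.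
have /choice[B BP] (i : 'I_(size s)) : exists B, 0 <= B /\
    forall y, `|coord b i y| <= B * eucl_norm ip y.
  by have [B B0 BP] := linear_bounded ip (coord b i); exists B.
(* [B1] exceeds every coordinate bound, so a point within [B1^-1] of [- e] has all its coordinates
   negative. *)
pose B1 := 1 + \sum_i B i.
have B_le i : B i < B1.
  rewrite /B1 (bigD1 i) //= addrCA ltrDl ltr_pwDl // sumr_ge0 // => j _.
  by have [] := BP j.
have B1_gt0 : 0 < B1.
  by rewrite ltr_pwDl // sumr_ge0 // => j _; have [] := BP j.
have [|c Cc] := clNe B1^-1; first by rewrite invr_gt0.
rewrite opprK => cNe.
have coord_e i : coord b i e = 1.
  rewrite linear_sum (bigD1 i) //= coord_free // eqxx big1 ?addr0 // => j ji.
  by rewrite coord_free // (negbTE ji).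
have c_lt0 i : coord b i c < 0.
  have [B_ge0 /(_ (c + e))] := BP i; rewrite linearD /= coord_e => le_c.
  suff : coord b i c + 1 < 1 by lra.
  apply: le_lt_trans (ler_norm _) (le_lt_trans le_c _).
  have n_ge0 := eucl_norm_ge0 ip (c + e).
  apply: (@le_lt_trans _ _ (B1 * eucl_norm ip (c + e))).
    by rewrite ler_wpM2r // ltW.
  by rewrite mulrC -ltr_pdivlMr // div1r.
move=> x Cx.
(* So large that [- x - l *: c] has nonnegative coordinates. *)
pose l := \sum_i `|coord b i x| / - coord b i c.
have l_ge i : coord b i x <= l * - coord b i c.
  rewrite -ler_pdivrMr ?oppr_gt0 // /l (bigD1 i) //= ler_wpDr //.
    by apply: sumr_ge0 => j _; rewrite divr_ge0 // oppr_ge0 ltW.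
  by rewrite ler_wpM2r ?ler_norm // invr_ge0 oppr_ge0 ltW.
have l_ge0 : 0 <= l.
  by apply: sumr_ge0 => j _; rewrite divr_ge0 // oppr_ge0 ltW.
have -> : - x = l *: c + \sum_i (- coord b i x - l * coord b i c) *: b`_i.
  rewrite {1}(@coord_span _ _ _ b _ (spanC x Cx)) {1}(@coord_span _ _ _ b _ (spanC c Cc)).
  rewrite scaler_sumr -big_split -sumrN /=; apply: eq_bigr => i _.
  rewrite scalerA -scalerDl -scaleNr; congr (_ *: _); ring.
apply: CD; first exact: CZ.
apply: convex_cone_sum => // i _.
by apply: CZ => //; have := l_ge i; rewrite mulrN; lra.
Qed.

(** Without such a [z], every functional nonnegative on [C' = C - R_+ p] vanishes on it. By
    [cone_opp] then [p] lies in [C'], so [(1 + t) p] lies in [C] for some [t >= 0]. *)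
Lemma proper_separation C p : convex_cone C -> ~ C p ->
  exists z, [/\ dual_cone ip C z, ip z p <= 0 &
                (exists2 c, C c & ip z c != 0) \/ ip z p != 0].
Proof.
move=> [C0 CD CZ] NCp.
pose C' := [set c - t *: p | c in C & t in [set t : R | 0 <= t]].
have C'cc : convex_cone C'.
  split; first by exists 0 => //; exists 0 => /=; rewrite // scale0r subr0.
    move=> _ _ [c Cc] [t /= t0 <-] [c' Cc'] [t' /= t'0 <-].
    exists (c + c'); first exact: CD.
    by exists (t + t'); rewrite /= ?addr_ge0 // scalerDl opprD addrACA.
  move=> s _ s0 [c Cc] [t /= t0 <-]; exists (s *: c); first exact: CZ.
  by exists (s * t); rewrite /= ?mulr_ge0 // scalerBr scalerA.
have C'C c : C c -> C' c.
  by move=> Cc; exists c => //; exists 0 => /=; rewrite // scale0r subr0.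
have C'p : C' (- p).
  by exists 0 => //; exists 1 => /=; rewrite // scale1r sub0r.
apply: contrapT => nosep; apply: NCp.
have [|c Cc [t /= t0]] := cone_opp C'cc _ C'p.
  move=> z zC'; have zp : ip z p <= 0 by have := zC' _ C'p; rewrite ipNr oppr_ge0.
  have zC : dual_cone ip C z by move=> c /C'C/zC'.
  apply/orthP => _ [c Cc] [t /= t0 <-]; rewrite !ipE.
  have [zc0|zc] := eqVneq (ip z c) 0; last first.
    by case: nosep; exists z; split=> //; left; exists c.
  have [zp0|zp'] := eqVneq (ip z p) 0; last by case: nosep; exists z; split=> //; right.
  by rewrite zc0 zp0 mulr0 subr0.
move=> /eqP; rewrite opprK subr_eq => /eqP cE.
have -> : p = (1 + t)^-1 *: c.
  by rewrite cE -[X in _ *: (X + _)]scale1r -scalerDl scalerA mulVf ?scale1r //; lra.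
by apply: CZ => //; rewrite invr_ge0; lra.
Qed.

End Cones.

(** * Facial reduction and duality *)

Section StrongDuality.
Context (R : realType).

(** The last hypothesis, taken at the supremum of [P], yields dual feasibility, the absence of a gap
    and attainment at once. *)
Lemma strong_duality_intro (P D : set R) : P !=set0 ->
    (forall p d, P p -> D d -> p <= d) ->
    (forall v, (forall p, P p -> p <= v) -> exists2 d, D d & d <= v) ->
  strong_duality P D.
Proof.
move=> P0 weak strong; rewrite /strong_duality; set valP := ereal_sup _.
have supE : (valP < +oo)%E -> has_ubound P /\ valP = (sup P)%:E.
  move=> valP_fin; have Pub : has_ubound P.
    by apply: contrapT => /hasNub_ereal_sup/(_ P0) E; rewrite /valP E ltxx in valP_fin.
  by split=> //; apply: ereal_sup_EFin.
split; first split.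
- move=> /supE[Pub _]; have [|d Dd _] := strong (sup P); last by exists d.
  by move=> p Pp; apply: ub_le_sup.
- move=> [d Dd]; apply: (@le_lt_trans _ _ d%:E); last exact: ltry.
  by apply: ge_ereal_sup => _ [p Pp <-]; rewrite lee_fin weak.
move=> /supE[Pub ->].
have [|d Dd dsup] := strong (sup P); first by move=> p Pp; apply: ub_le_sup.
have supD e : D e -> sup P <= e by move=> De; apply: ge_sup => // p /weak; apply.
have dE : d = sup P by apply/eqP; rewrite eq_le dsup supD.
have infE : ereal_inf [set e%:E | e in D] = (sup P)%:E.
  apply/eqP; rewrite eq_le; apply/andP; split.
    by apply: ereal_inf_lbound; exists d; rewrite // dE.
  by apply: le_ereal_inf_tmp => _ [e De <-]; rewrite lee_fin supD.
by rewrite infE; split=> //; exists d => //; rewrite dE.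
Qed.

End StrongDuality.

Section FacialReduction.
Context (R : realType) (Y : vectType R) (ip : {dot Y for idfun}).
Implicit Types (C E K : set Y) (y z u v : Y).

(* For a cone this is the algebraic form of the relative interior. *)
Definition cone_core C : set Y :=
  [set x | C x /\ forall y, C y -> exists2 e : R, 0 < e & C (x - e *: y)].

(** The sum of a basis of the span lying in [C] is a core point: after subtracting a small multiple
    of [y] its coordinates remain nonnegative. *)
Lemma cone_core_nonempty C : convex_cone C -> cone_core C !=set0.
Proof.
move=> Ccc; have [C0 CD CZ] := Ccc.
have [s [fs sC spanC]] := cone_basis C.
pose b := in_tuple s.
have bC (i : 'I_(size s)) : C b`_i by apply: sC; exact: mem_nth.
exists (\sum_(i < size s) b`_i); split; first exact: convex_cone_sum.
move=> y Cy; pose B := 1 + \sum_i `|coord b i y|.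
have B_gt0 : 0 < B by rewrite ltr_pwDl // sumr_ge0.
exists B^-1; first by rewrite invr_gt0.
rewrite (@coord_span _ _ _ b _ (spanC y Cy)) scaler_sumr -sumrB.
apply: convex_cone_sum => // i _.
rewrite -[X in C (X - _)]scale1r scalerA -scalerBl; apply: CZ => //.
rewrite subr_ge0 mulrC ler_pdivrMr // mul1r (le_trans (ler_norm _)) //.
by rewrite /B (bigD1 i) //= addrCA lerDl addr_ge0 // sumr_ge0.
Qed.

Lemma cone_coreD C x y : convex_cone C ->
  cone_core C x -> C y -> cone_core C (x + y).
Proof.
move=> [C0 CD CZ] [Cx xP] Cy; split; first exact: CD.
move=> z /xP[e e0 Cz]; exists e => //.
by rewrite addrAC; apply: CD.
Qed.

Lemma cone_coreZ C (t : R) x : convex_cone C -> 0 < t ->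
  cone_core C x -> cone_core C (t *: x).
Proof.
move=> [C0 CD CZ] t0 [Cx xP]; split; first by apply: CZ => //; exact: ltW.
move=> z /xP[e e0 Cz]; exists (t * e); first exact: mulr_gt0.
by rewrite -scalerA -scalerBr; apply: CZ => //; exact: ltW.
Qed.

(** If [z] were positive at [y], it would be negative at [x - e *: y], which lies in [C] for some
    [e > 0]. *)
Lemma dual_core_orth C x z : cone_core C x -> dual_cone ip C z ->
  ip z x <= 0 -> orth ip C z.
Proof.
move=> [Cx xP] zC zx; apply/orthP => y Cy; apply/eqP.
rewrite eq_le zC // andbT; have [e e0 /zC] := xP y Cy.
rewrite !ipE => H; have : e * ip z y <= 0 by lra.
by rewrite pmulr_rle0.
Qed.

Definition expface K u : set Y := K `&` [set x | ip u x = 0].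

Lemma expface_sub K u : expface K u `<=` K. Proof. by move=> x []. Qed.

Lemma expface_cone K u : convex_cone K -> convex_cone (expface K u).
Proof.
move=> [K0 KD KZ]; split; first by split; rewrite //= ip0r.
  by move=> x y [Kx /= ux] [Ky /= uy]; split; [exact: KD | rewrite /= ipDr ux uy addr0].
by move=> t x t0 [Kx /= ux]; split; [exact: KZ | rewrite /= ipZr ux mulr0].
Qed.

(** Two nonnegative numbers with sum zero both vanish. This is why partial sums record successive
    cuts of the face. *)
Lemma expfaceD K u u' : dual_cone ip K u -> dual_cone ip K u' ->
  expface K (u + u') = expface K u `&` [set x | ip u' x = 0].
Proof.
move=> uK u'K; apply/seteqP; split=> x; last first.
  by move=> [[Kx /= ux] /= u'x]; split; rewrite //= ipDl ux u'x addr0.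
move=> [Kx /=]; rewrite ipDl => uu'x.
by have := uK x Kx; have := u'K x Kx; do !split=> //=; lra.
Qed.

Lemma dual_coneS C C' : C `<=` C' -> dual_cone ip C' `<=` dual_cone ip C.
Proof. by move=> CC' z zC' x /CC'/zC'. Qed.

Lemma orthS C C' : C `<=` C' -> orth ip C' `<=` orth ip C.
Proof. by move=> CC' z /orthP zC'; apply/orthP => x /CC'/zC'. Qed.

Lemma orth0 C : orth ip C 0.
Proof. by apply/orthP => x _; rewrite ip0l. Qed.

Lemma orthD C u v : orth ip C u -> orth ip C v -> orth ip C (u + v).
Proof.
by move=> /orthP uC /orthP vC; apply/orthP => x Cx; rewrite ipDl uC ?vC ?addr0.
Qed.

Lemma orth_dual C u : orth ip C u -> dual_cone ip C u.
Proof. by move=> /orthP uC x /uC ->. Qed.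

(* [S] plays the role of the space of symmetric matrices inside the space of
   all matrices: it contains [K], the range of [A] and [b] up to a projection
   which does not change inner products with them. *)
Context (X : lmodType R) (A : {linear X -> Y}) (b : Y) (K : set Y).
Context (S L : {vspace Y}) (ell : nat).
Context (K_cone : convex_cone K).
Context (S_proj : forall y, exists y', [/\ y' \in S,
  forall k, K k -> ip y' k = ip y k & forall x, ip y' (A x) = ip y (A x)]).
Context (memL : forall y,
  y \in L <-> [/\ y \in S, forall x, ip y (A x) = 0 & ip y b = 0]).

(** A functional nonnegative on [C = E + range A + R b] kills [A] and [b]; its projection to [S]
    lies in [L], so it also kills [E]. By [cone_opp], [C] contains the opposite of a core point
    [e0], which expresses [e0 + f] through [A] and [b]. *)
Lemma core_slack E x0 : convex_cone E -> E `<=` K -> E (b - A x0) ->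
    (forall y, y \in L -> dual_cone ip E y -> orth ip E y) ->
  exists x, cone_core E (b - A x).
Proof.
move=> Ecc EK Ex0 termE; have [E0 ED EZ] := Ecc.
pose C := [set w | exists f x t, E f /\ w = f + A x + t *: b].
have Ccc : convex_cone C.
  split; first by exists 0, 0, 0; rewrite linear0 scale0r !addr0.
    move=> _ _ [f [x [t [Ef ->]]]] [f' [x' [t' [Ef' ->]]]].
    exists (f + f'), (x + x'), (t + t'); split; first exact: ED.
    by rewrite linearD scalerDl addrACA (addrACA f).
  move=> s _ s0 [f [x [t [Ef ->]]]]; exists (s *: f), (s *: x), (s * t).
  by split; [exact: EZ | rewrite linearZ -scalerA !scalerDr].
have EC f : E f -> C f.
  by move=> Ef; exists f, 0, 0; rewrite linear0 scale0r !addr0.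
have [e0 [Ee0 e0P]] := cone_core_nonempty Ecc.
have dualC : dual_cone ip C `<=` orth ip C.
  move=> z zC.
  have zA x : ip z (A x) = 0.
    have CA x1 : C (A x1) by exists 0, x1, 0; rewrite add0r scale0r addr0.
    by have := zC _ (CA x); have := zC _ (CA (- x)); rewrite linearN ipNr; lra.
  have zb : ip z b = 0.
    have Cb t : C (t *: b) by exists 0, 0, t; rewrite add0r linear0 add0r.
    by have := zC _ (Cb 1); have := zC _ (Cb (- 1)); rewrite !ipZr; lra.
  have [z' [Sz' z'K z'A]] := S_proj z.
  have z'b : ip z' b = 0.
    by rewrite -[b](subrK (A x0)) ipDr z'A z'K; [rewrite -ipDr subrK | exact: EK].
  have /orthP z'E : orth ip E z'.
    apply: termE; first by apply/memL; split=> // x; rewrite z'A.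
    by move=> k Ek; rewrite z'K; [exact/zC/EC | exact: EK].
  apply/orthP => _ [f [x [t [Ef ->]]]].
  by rewrite !ipE zA zb -z'K ?z'E; [rewrite mulr0 !addr0 | | exact: EK].
have [f [x [t [Ef eq_e0]]]] := cone_opp Ccc dualC (EC _ Ee0).
(* Adding [l *: (b - A x0)] to [e0 + f = - A x - t *: b] gives [b] the coefficient [m = l - t > 0];
   dividing by [m] produces a slack. *)
pose l := `|t| + 1; pose m := l - t.
have l_ge0 : 0 <= l by rewrite addr_ge0.
have m_gt0 : 0 < m by rewrite /m /l; have := ler_norm t; lra.
exists (m^-1 *: (l *: x0 + x)).
have -> : b - A (m^-1 *: (l *: x0 + x)) = m^-1 *: (e0 + (f + l *: (b - A x0))).
  have -> : e0 = - (f + (A x + t *: b)) by rewrite addrA -eq_e0 opprK.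
  rewrite opprD [- f - _ + _]addrC addrACA subrr add0r.
  rewrite linearZ -[X in X - _]scale1r -(mulVf (lt0r_neq0 m_gt0)) -scalerA -scalerBr.
  congr (_ *: _); rewrite linearD linearZ scalerBr /m scalerBl !opprD.
  by rewrite addrACA [- (t *: b) - _]addrC.
apply: cone_coreZ; rewrite ?invr_gt0 //; apply: cone_coreD => //.
by apply: ED => //; apply: EZ.
Qed.

(** One step of the extended system: for closed [K] and [u] in its dual cone, the last condition is
    the tangent space condition, by [tan_dual]. *)
Definition dual_pair u u' v' : Prop :=
  [/\ u' \in S, dual_cone ip K u', v' \in S & orth ip (expface K u) v'].

Definition reduction k (u v : nat -> Y) : Prop :=
  [/\ u 0%N = 0, v 0%N = 0 & forall i, (i < k)%N ->
    dual_pair (u i) (u i.+1) (v i.+1) /\ u i.+1 + v i.+1 \in L].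

Definition terminal u : Prop :=
  forall y, y \in L -> dual_cone ip (expface K u) y -> orth ip (expface K u) y.

(** By induction: [u i.+1 + v i.+1] lies in [L] and so kills slacks, and [v i.+1] kills the previous
    face, hence [u i.+1] kills the slack. *)
Lemma reduction_slack k (u v : nat -> Y) x i : reduction k u v -> K (b - A x) ->
  (i <= k)%N -> expface K (u i) (b - A x).
Proof.
move=> [u0 v0 uvP] Kx; elim: i => [|i IH] ik; first by split; rewrite //= u0 ip0l.
have [[_ _ _ /orthP vi] /memL[_ uvA uvb]] := uvP i ik.
split=> //=; have := vi _ (IH (ltnW ik)).
suff : ip (u i.+1 + v i.+1) (b - A x) = 0 by rewrite ipDl; lra.
by rewrite ipDr ipNr uvA uvb subr0.
Qed.

(** Holds for an arbitrary reduction, not only for the one constructed: [u i] is nonnegative on [E]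
    and vanishes at a core point of it. *)
Lemma reduction_orth k (u v : nat -> Y) E x : reduction k u v -> E `<=` K ->
    cone_core E (b - A x) ->
  forall i, (i <= k)%N -> orth ip E (u i).
Proof.
move=> red EK coreE [|i] ik; first by case: red => -> _ _; apply: orth0.
have [u0 v0 uvP] := red; have [[_ uK _ _] _] := uvP i ik.
apply: (dual_core_orth coreE); first exact: dual_coneS uK.
have [] // := reduction_slack red (EK _ (proj1 coreE)) ik.
by move=> _ /= ->.
Qed.

Lemma sub_expface E u : E `<=` K -> orth ip E u -> E `<=` expface K u.
Proof. by move=> EK /orthP uE x Ex; split; [exact: EK | exact: uE]. Qed.

Lemma dual_pair_dual E u u' v' : E `<=` K -> orth ip E u ->
  dual_pair u u' v' -> u' + v' \in S /\ dual_cone ip E (u' + v').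
Proof.
move=> EK uE [Su' u'K Sv' vE]; split; first exact: memvD.
move=> x Ex; have /orthP/(_ x (sub_expface EK uE Ex)) v'x := vE.
by rewrite ipDl v'x addr0; exact/u'K/EK.
Qed.

(* Invariant of facial reduction before it terminates: the faces shrink
   strictly, and each step contributes a new vector [y] to a free family
   in [L]. *)
Definition strict_reduction k (u v : nat -> Y) : Prop :=
  [/\ reduction k u v,
      [/\ u k \in S, dual_cone ip K (u k), orth ip (expface K (u k)) (v k)
        & v k \in S /\ u k + v k \in L],
      forall i, (i < k)%N -> expface K (u i.+1) `<` expface K (u i)
    & exists s : seq Y, [/\ free s, size s = k, {subset s <= L}
        & {in s, forall y, orth ip (expface K (u k)) y}]].

(** The abstract form in which niceness enters. *)
Context (dual_split : forall u y, u \in S -> dual_cone ip K u -> y \in S ->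
  dual_cone ip (expface K u) y -> exists u' v', y = u' + v' /\ dual_pair u u' v').

(** The vectors found earlier vanish on the current face while the new [y] does not, so [y] is
    independent of them; it vanishes on the new face, where both [p] and [q] do. *)
Lemma strict_reductionS k (u v : nat -> Y) : strict_reduction k u v -> ~ terminal (u k) ->
  exists u' v' : nat -> Y, strict_reduction k.+1 u' v'.
Proof.
move=> [[u0 v0 uvP] [Suk ukK vk [Svk uvL]] strict [s [fs sk sL s_orth]]].
move=> /existsNP[y /not_implyP[yL /not_implyP[yE y_north]]].
have [Sy _ _] := (memL y).1 yL.
have [p [q [y_eq [Sp pK Sq q_orth]]]] := dual_split Suk ukK Sy yE.
have face_eq := expfaceD ukK pK.
have face_sub : expface K (u k + p) `<=` expface K (u k) by rewrite face_eq; move=> x [].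
pose u' i := if i == k.+1 then u k + p else u i.
pose v' i := if i == k.+1 then v k + q else v i.
have u'E i : (i <= k)%N -> u' i = u i by rewrite /u' => ik; rewrite ltn_eqF.
have v'E i : (i <= k)%N -> v' i = v i by rewrite /v' => ik; rewrite ltn_eqF.
have u'k : u' k.+1 = u k + p by rewrite /u' eqxx.
have v'k : v' k.+1 = v k + q by rewrite /v' eqxx.
have S_u'k : u k + p \in S by exact: memvD.
have K_u'k : dual_cone ip K (u k + p).
  by have [_ D _] := dual_convex_cone ip K; exact: D.
have S_v'k : v k + q \in S by exact: memvD.
have uv'L : u k + p + (v k + q) \in L by rewrite addrACA -y_eq memvD.
exists u', v'; split.
- split=> [||i]; [by rewrite u'E | by rewrite v'E | rewrite ltnS leq_eqVlt].
  move=> /predU1P[->|ik].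
    by rewrite u'k v'k u'E //; split=> //; split=> //; exact: orthD.
  by rewrite !u'E ?v'E ?(ltnW ik) //; exact: uvP.
- rewrite u'k v'k; split=> //.
  by apply: orthS face_sub _ _; exact: orthD.
- move=> i; rewrite ltnS leq_eqVlt => /predU1P[->|ik]; last first.
    by rewrite !u'E ?(ltnW ik) //; exact: strict.
  rewrite u'k u'E //; split=> // sub; apply: y_north.
  apply/orthP => x Ex; rewrite y_eq ipDl.
  have /orthP -> // := q_orth; rewrite addr0.
  by have := sub x Ex; rewrite face_eq => -[].
exists (y :: s); rewrite u'k /= sk; split=> //.
- rewrite free_cons fs andbT; apply/negP => ys; apply: y_north; apply/orthP => x Ex.
  move: ys => /(@coord_span _ _ _ (in_tuple s)) ->; rewrite ip_suml big1 // => i _.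
  have /orthP orth_i : orth ip (expface K (u k)) (in_tuple s)`_i.
    by apply: s_orth; exact: mem_nth.
  by rewrite ipZl orth_i ?mulr0.
- by move=> z; rewrite inE => /predU1P[->|/sL].
- move=> z; rewrite inE => /predU1P[->|/s_orth]; last exact: orthS.
  apply/orthP => x Ex; rewrite y_eq ipDl.
  have /orthP -> := q_orth; last exact: face_sub.
  by rewrite addr0; move: Ex; rewrite face_eq => -[].
Qed.

Lemma strict_reduction0 : strict_reduction 0 (fun=> 0) (fun=> 0).
Proof.
split=> //; last by exists [::]; split=> //; exact: nil_free.
split; rewrite ?addr0 ?mem0v //; first by move=> x _; rewrite ip0l.
exact: orth0.
Qed.

Lemma terminal_reduction k : (exists u v : nat -> Y, strict_reduction k u v) \/
  exists j (u v : nat -> Y), [/\ (j < k)%N, strict_reduction j u v & terminal (u j)].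
Proof.
elim: k => [|k [[u [v uvk]]|[j [u [v [jk uvj term]]]]]].
- by left; exists (fun=> 0), (fun=> 0); exact: strict_reduction0.
- have [term|/(strict_reductionS uvk)] := pselect (terminal (u k)); last by left.
  by right; exists k, u, v.
- by right; exists j, u, v; rewrite ltnW.
Qed.

(** Two ways to exclude [ell + 1] strict steps: through the free family in [L], or through the
    decreasing faces. *)
Context (ell_bound : (\dim L <= ell)%N \/ forall u : nat -> Y,
  (forall i, (i <= ell.+1)%N -> u i \in S /\ dual_cone ip K (u i)) ->
  ~ (forall i, (i <= ell)%N -> expface K (u i.+1) `<` expface K (u i))).
Context (x0 : X) (x0_feasible : K (b - A x0)).

Lemma facial_reduction : exists u v : nat -> Y, [/\ reduction ell u v,
  u ell \in S, dual_cone ip K (u ell)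
  & exists x, cone_core (expface K (u ell)) (b - A x)].
Proof.
have [[u [v [[u0 _ uvP] [Su Ku _ _] strict [s [fs sk sL _]]]]]|] :=
    terminal_reduction ell.+1.
  case: ell_bound => [dimL|/(_ u)[]].
  - have : (\dim <<s>> <= \dim L)%N by apply/dimvS/span_subvP.
    by rewrite (eqnP fs) sk leqNgt ltnS dimL.
  - move=> [_|i]; first by rewrite u0 mem0v; split=> // x _; rewrite ip0l.
    by rewrite ltnS => ik; have [[]] := uvP i ik.
  - by move=> i ik; apply: strict.
move=> [j [u [v [jk [[u0 v0 uvP] [Su Ku vj [Sv uvL]] _ _] term]]]].
(* The last pair is repeated up to step [ell]; this is admissible since [v j] is orthogonal to the
   face of [u j] and [u j + v j] is in [L]. *)
have red : reduction ell (fun i => u (minn i j)) (fun i => v (minn i j)).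
  split; rewrite ?min0n // => i ik; have [ij|ji] := ltnP i j.
    by rewrite !(minn_idPl _) ?(ltnW ij) //; exact: uvP.
  by rewrite !(minn_idPr _) // (leq_trans ji).
have ell_j : minn ell j = j by apply/minn_idPr.
exists (fun i => u (minn i j)), (fun i => v (minn i j)); rewrite ell_j; split=> //.
apply: (@core_slack _ x0) => //; first exact: expface_cone.
  exact: expface_sub.
by have := reduction_slack red x0_feasible (leqnn ell); rewrite ell_j.
Qed.

(** Forwards, [dual_split] supplies a final pair for the given reduction. Backwards,
    [reduction_orth] shows that any reduction ends with a face containing that of [w]. *)
Lemma dual_expfaceE w : w \in S -> dual_cone ip K w ->
    (exists u v : nat -> Y, reduction ell u v /\ w = u ell) ->
    (exists x, cone_core (expface K w) (b - A x)) ->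
  forall y, y \in S /\ dual_cone ip (expface K w) y <->
    exists u v : nat -> Y, [/\ reduction ell u v, dual_pair (u ell) (u ell.+1) (v ell.+1)
      & y = u ell.+1 + v ell.+1].
Proof.
move=> Sw wK [u [v [[u0 v0 uvP] wE]]] [x core_x] y; split.
  move=> [Sy yE]; have [p [q [y_eq pq]]] := dual_split Sw wK Sy yE.
  exists (fun i => if i == ell.+1 then p else u i).
  exists (fun i => if i == ell.+1 then q else v i).
  rewrite eqxx (ltn_eqF (ltnSn ell)) -wE; split=> //.
  split=> // i ik; rewrite eqSS (ltn_eqF ik) (ltn_eqF (leqW ik)); exact: uvP.
move=> [u' [v' [red' pair' ->]]].
apply: (dual_pair_dual (@expface_sub _ _) _ pair').
exact: (reduction_orth red' (@expface_sub _ _) core_x).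
Qed.

(** The core slack is a Slater point for [E]. Proper separation yields [y] whose image under the
    adjoint is [r] times [c], with [ip y b <= v * r]; the Slater point forces [r > 0], and [y / r]
    is the dual solution. *)
Lemma core_strong_duality (E : set Y) (c : {scalar X}) x1 :
    convex_cone E -> E `<=` K -> cone_core E (b - A x1) ->
    (forall x, K (b - A x) -> E (b - A x)) ->
  strong_duality [set c x | x in [set x | K (b - A x)]]
    [set ip b y | y in [set y | [/\ y \in S, dual_cone ip E y
                                  & forall x, ip y (A x) = c x]]].
Proof.
move=> Ecc EK core_x1 slackE; have [E0 ED EZ] := Ecc.
apply: strong_duality_intro; first by exists (c x0), x0.
  move=> _ _ [x Kx <-] [y [_ yE yc] <-].
  by have := yE _ (slackE x Kx); rewrite ipDr ipNr yc ipC subr_ge0.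
move=> v vub.
suff [y [yE yc yb]] : exists y, [/\ dual_cone ip E y,
    forall x, ip y (A x) = c x & ip b y <= v].
  (* The separation happens in the whole space. Projecting to [S] keeps the products with [K] and
     the range of [A], hence with [b], a slack plus [A x0]. *)
  have [y' [Sy' y'K y'A]] := S_proj y.
  have y'b : ip y' b = ip y b.
    by rewrite -[b](subrK (A x0)) ipDr [RHS]ipDr y'A y'K.
  exists (ip b y'); last by rewrite ipC y'b ipC.
  exists y' => //; split=> // [z Ez|x]; last by rewrite y'A.
  by rewrite y'K ?yE //; exact: EK.
have [c0|/existsNP[x2 /eqP c_neq0]] := pselect (forall x, c x = 0).
  exists 0; split=> [z _|x|]; rewrite ?ip0l ?ip0r ?c0 //.
  by rewrite -(c0 x0); apply: vub; exists x0.
have [xc cxc] : exists xc, c xc = 1.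
  by exists ((c x2)^-1 *: x2); rewrite linearZ /= mulVf.
(* The sup [v] is not exceeded: no [x] with [c x = 1 + t v] has [t b - A x] in
   the face [E], i.e. [- A xc] lies outside of the cone [W]. *)
pose W := [set w | exists f x t, [/\ E f, c x = 0, 0 <= t
  & w = f + A x + t *: (v *: A xc - b)]].
have W_cone : convex_cone W.
  split; first by exists 0, 0, 0; rewrite !linear0 scale0r !addr0.
    move=> _ _ [f [x [t [Ef cx t0 ->]]]] [f' [x' [t' [Ef' cx' t'0 ->]]]].
    exists (f + f'), (x + x'), (t + t'); split; rewrite ?addr_ge0 //.
    - exact: ED.
    - by rewrite linearD /= cx cx' addr0.
    - by rewrite linearD scalerDl addrACA (addrACA f).
  move=> s _ s0 [f [x [t [Ef cx t0 ->]]]].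
  exists (s *: f), (s *: x), (s * t); split; rewrite ?mulr_ge0 //.
  - exact: EZ.
  - by rewrite linearZ /= cx mulr0.
  - by move: (_ - b) => g; rewrite linearZ -scalerA !scalerDr.
have NW : ~ W (- A xc).
  move=> [f [x [t [Ef cx t0 eqf]]]].
  pose x3 := x + (1 + t * v) *: xc.
  have cx3 : c x3 = 1 + t * v by rewrite linearD linearZ /= cx cxc mulr1 add0r.
  have fE : f = t *: b - A x3.
    have -> : f = - A xc - (A x + t *: (v *: A xc - b)) by rewrite eqf -(addrA f) addrK.
    rewrite [A x3]linearD [A (_ *: xc)]linearZ /= scalerDl scale1r.
    rewrite scalerBr scalerA !opprD opprK.
    by rewrite addrCA [RHS]addrC !addrA.
  (* For [t = 0], [x3] is a recession direction with [c x3 = 1], and [r] steps along it from [x1]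
     exceed [v]; for [t > 0], [x3 / t] is feasible with value [v + 1 / t]. *)
  have [t_eq0|t_neq0] := eqVneq t 0.
    pose r := `|v - c x1| + 1.
    have r_ge0 : 0 <= r by rewrite addr_ge0.
    have /vub : [set c x | x in [set x | K (b - A x)]] (c (x1 + r *: x3)).
      exists (x1 + r *: x3) => //=.
      have -> : b - A (x1 + r *: x3) = (b - A x1) + r *: f.
        by rewrite fE t_eq0 scale0r sub0r linearD linearZ scalerN opprD addrA.
      by apply/EK/ED; [case: core_x1 | exact: EZ].
    rewrite linearD linearZ /= cx3 t_eq0 mul0r addr0 mulr1 /r.
    by have := ler_norm (v - c x1); lra.
  have t_gt0 : 0 < t by rewrite lt_def t_neq0.
  have /vub : [set c x | x in [set x | K (b - A x)]] (c (t^-1 *: x3)).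
    exists (t^-1 *: x3) => //=; apply: EK.
    have -> : b - A (t^-1 *: x3) = t^-1 *: f.
      by rewrite fE scalerBr scalerA mulVf // scale1r linearZ.
    by apply: EZ; rewrite // invr_ge0.
  rewrite linearZ /= cx3 mulrDr mulrA mulVf // mul1r mulr1.
  have tV_gt0 : 0 < t^-1 by rewrite invr_gt0.
  by lra.
have [y [yW ypos y_neq0]] := proper_separation ip W_cone NW.
pose r := ip y (A xc).
have r_ge0 : 0 <= r by move: ypos; rewrite ipNr /r; lra.
have yE : dual_cone ip E y.
  move=> f Ef; apply: yW; exists f, 0, 0.
  by rewrite !linear0 scale0r !addr0.
have yA x : ip y (A x) = c x * r.
  have yker x' : c x' = 0 -> ip y (A x') = 0.
    move=> cx'; have WA s : W (A (s *: x')).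
      exists 0, (s *: x'), 0; rewrite add0r scale0r addr0.
      by rewrite linearZ /= cx' mulr0.
    have := yW _ (WA 1); have := yW _ (WA (- 1)).
    by rewrite ![A (_ *: x')]linearZ /= !ipZr; lra.
  have /yker : c (x - c x *: xc) = 0 by rewrite linearB linearZ /= cxc mulr1 subrr.
  rewrite [A _]linearB [A (_ *: _)]linearZ /= ipDr ipNr ipZr => /eqP.
  by rewrite subr_eq0 => /eqP.
have yb : ip y b <= v * r.
  have : W (v *: A xc - b).
    by exists 0, 0, 1; rewrite !linear0 scale1r !add0r.
  by move/yW; rewrite ipDr ipNr ipZr subr_ge0.
(* If [r = 0], then [y] kills the core slack, hence [E], [b] and the range of [A], so all of [W] and
   [- A xc]: the separation would not be proper. *)
have [r0|r_neq0] := eqVneq r 0.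
  have y_orth : orth ip E y.
    apply: (dual_core_orth core_x1 yE).
    by rewrite ipDr ipNr yA r0 mulr0 subr0; move: yb; rewrite r0 mulr0.
  have yb0 : ip y b = 0.
    have /orthP/(_ _ (proj1 core_x1)) := y_orth.
    by rewrite ipDr ipNr yA r0 mulr0 subr0.
  case: y_neq0 => [[_ [f [x [t [Ef cx t0 ->]]]]]|]; rewrite !ipE !yA r0.
    have /orthP -> // := y_orth.
    by rewrite yb0 !mulr0 subrr mulr0 !addr0 eqxx.
  by rewrite mulr0 oppr0 eqxx.
have r_gt0 : 0 < r by rewrite lt_def r_neq0.
exists (r^-1 *: y); split=> [f Ef|x|]; rewrite ?ipZl ?ipZr.
- by rewrite mulr_ge0 ?yE // invr_ge0.
- by rewrite yA mulrCA mulVf // mulr1.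
- by rewrite ipC mulrC ler_pdivrMr.
Qed.

End FacialReduction.

(** * Nice cones *)

Section NiceCones.
Context (R : realType) (Y : vectType R) (ip : {dot Y for idfun}).
Implicit Types (C E F K : set Y) (x y z u v : Y).

Lemma dual_cone_closed C : eucl_closed ip (dual_cone ip C).
Proof.
move=> z clz x Cx; rewrite leNgt; apply/negP => zx_lt0.
have n0 := eucl_norm_ge0 ip x.
have [|y yC yz] := clz (- ip z x / (eucl_norm ip x + 1)).
  by rewrite divr_gt0 ?oppr_gt0 ?ltr_wpDl.
move: yz; rewrite ltr_pdivlMr ?ltr_wpDl // => yz.
have := ip_le_norm ip (y - z) x; rewrite ipDl ipNl => le_n.
have := yC x Cx; have := ler_norm (ip y x - ip z x).
by have := eucl_norm_ge0 ip (y - z); lra.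
Qed.

Lemma orth_cone C : convex_cone (orth ip C).
Proof.
split; [exact: orth0 | by move=> x y; exact: orthD |].
by move=> t x _ /orthP xC; apply/orthP => y Cy; rewrite ipZl xC ?mulr0.
Qed.

(** The point [x] divides the segment from [y] to [x + e *: (x - y)] with weights [e / (1 + e)] and
    [1 / (1 + e)]. *)
Lemma face_absorb F K x y e : face F K -> F x -> K y -> 0 < e ->
  K (x + e *: (x - y)) -> F y.
Proof.
move=> [_ _ FP] Fx Ky e0 Kz; have e1 : 0 < 1 + e by rewrite addr_gt0.
have e1_neq0 : 1 + e != 0 by rewrite gt_eqF.
have [] // := FP _ _ Ky Kz; exists x; split=> //.
exists (e / (1 + e)) => /=; first by rewrite divr_gt0 //= ltr_pdivrMr // mul1r ltrDr.
have -> : 1 - e / (1 + e) = (1 + e)^-1 by field.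
have -> : x + e *: (x - y) = (1 + e) *: x - e *: y.
  by rewrite scalerBr addrA -[X in X + _ - _]scale1r -scalerDl.
rewrite scalerBr !scalerA mulVf // scale1r [e / _]mulrC.
by rewrite addrC subrK.
Qed.

Lemma relint_extend C x y : relint ip C x -> C y ->
  exists2 e : R, 0 < e & C (x + e *: (x - y)).
Proof.
move=> [Cx [e e0 xP]] Cy; have n1 : 0 < eucl_norm ip (x - y) + 1.
  by rewrite ltr_wpDl ?eucl_norm_ge0.
pose d := e / (eucl_norm ip (x - y) + 1).
have d0 : 0 < d by rewrite divr_gt0.
exists d => //; apply: xP.
  exists 2%N, (fun i => if i == ord0 then x else y).
  exists (fun i => if i == ord0 then 1 + d else - d); split.
  - by move=> i; case: ifP.
  - by rewrite !big_ord_recl big_ord0 /= addr0 addrK.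
  - rewrite !big_ord_recl big_ord0 /= addr0 scalerBr addrA scaleNr.
    by rewrite -[X in X + _ - _]scale1r -scalerDl.
rewrite addrAC subrr add0r eucl_normZ gtr0_norm // mulrC /d mulrA ltr_pdivrMr //.
by rewrite mulrDr mulr1 mulrC ltrDl.
Qed.

Lemma expface_face K u : convex_cone K -> dual_cone ip K u ->
  face (expface ip K u) K.
Proof.
move=> Kcc uK; split; first exact: expface_sub.
  exact/convex_cone_convex/expface_cone.
move=> x y Kx Ky [_ [[t /= /andP[t0 t1] <-] [_ /=]]]; rewrite ipDr !ipZr => H.
have ux := uK x Kx; have uy := uK y Ky.
have tx : 0 <= t * ip u x by rewrite mulr_ge0 // ltW.
have ty : 0 <= (1 - t) * ip u y by rewrite mulr_ge0 // subr_ge0 ltW.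
have /eqP : t * ip u x = 0 by lra.
have /eqP : (1 - t) * ip u y = 0 by lra.
rewrite !mulf_eq0 subr_eq0 (gt_eqF t1) (gt_eqF t0) /= => /eqP uy0 /eqP ux0.
by split; split.
Qed.

Lemma dir_cone C u : convex_cone C -> C u -> convex_cone (dir u C).
Proof.
move=> [C0 CD CZ] Cu; split.
- by exists 1; rewrite ?scaler0 ?addr0.
- move=> x y [s s0 Cx] [t t0 Cy]; have st : 0 < s + t by rewrite addr_gt0.
  have st_neq0 : s + t != 0 by rewrite gt_eqF.
  (* The step length for which the endpoint is a convex combination of [u + s *: x] and
     [u + t *: y]. *)
  exists (s * t / (s + t)); first by rewrite divr_gt0 ?mulr_gt0.
  have -> : u + (s * t / (s + t)) *: (x + y) =
      (t / (s + t)) *: (u + s *: x) + (s / (s + t)) *: (u + t *: y).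
    rewrite !scalerDr !scalerA addrACA -scalerDl; congr (_ + (_ + _)).
    + by rewrite -mulrDl [t + s]addrC divff // scale1r.
    + by congr (_ *: _); field.
    + by congr (_ *: _); field.
  by apply: CD; apply: CZ => //; rewrite divr_ge0 ?ltW.
- move=> a x a0 [s s0 Cx]; have [->|a_neq0] := eqVneq a 0.
    by exists 1; rewrite // scale0r scaler0 addr0.
  exists (s / a); first by rewrite divr_gt0 // lt_def a_neq0.
  by rewrite scalerA divfK.
Qed.

(** Feasible directions are nonnegative on the face, hence so are their limits. Conversely, a [z]
    separating [w] from the directions lies in [K] by [bipolar], and is orthogonal to [u] because
    [u] and [- u] are directions; so [z] is in the face, where [w] vanishes. *)
Lemma tan_dual K u : eucl_closed ip K -> convex_cone K -> dual_cone ip K u ->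
  tan ip u (dual_cone ip K) = orth ip (expface ip K u).
Proof.
move=> Kcl Kcc uK; have Dcc := dual_convex_cone ip K; have [D0 DD DZ] := Dcc.
have dir_dual : dir u (dual_cone ip K) `<=` dual_cone ip (expface ip K u).
  move=> y [t t0 ty] x [Kx /= ux]; have := ty x Kx.
  by rewrite ipDl ipZl ux add0r pmulr_rge0.
have cl_dual : eucl_closure ip (dir u (dual_cone ip K)) `<=`
               dual_cone ip (expface ip K u).
  move=> y cly; apply: dual_cone_closed => e /cly[z /dir_dual zE zy].
  by exists z.
apply/seteqP; split=> v.
  move=> [/cl_dual vE /= /cl_dual vE']; apply/orthP => x Ex.
  by have := vE x Ex; have := vE' x Ex; rewrite ipNl; lra.
suff orth_cl w : orth ip (expface ip K u) w ->
    eucl_closure ip (dir u (dual_cone ip K)) w.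
  move=> vE; split; first exact: orth_cl.
  apply: orth_cl; apply/orthP => x Ex.
  by have /orthP/(_ x Ex) := vE; rewrite ipNl => ->; rewrite oppr0.
have dcc := dir_cone Dcc uK.
move=> /orthP wE; apply: contrapT.
move=> /(separation (@eucl_closure_closed _ _ ip _) (convex_cone_closure ip dcc)).
move=> [z zP]; have zdir y : dir u (dual_cone ip K) y -> 0 <= ip z y.
  by move=> dy; apply: zP; exact: sub_eucl_closure.
have Kz : K z.
  apply: (bipolar Kcl Kcc) => k kK; apply: zdir; exists 1; rewrite // scale1r.
  exact: DD.
have zu : ip u z = 0.
  have /zdir : dir u (dual_cone ip K) u by exists 1; rewrite // scale1r; exact: DD.
  have /zdir : dir u (dual_cone ip K) (- u) by exists 1; rewrite // scale1r subrr.
  by rewrite ipNr (ipC ip z u); lra.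
by rewrite ipC wE ?ltxx.
Qed.

(** By niceness [M] is closed, so a [y] outside it could be separated by some [z]. Such a [z] lies
    in [K] by [bipolar] and is orthogonal to [u], so it is in the face, where [y] is nonnegative. *)
Lemma nice_dual_split K u y : nice ip K -> convex_cone K -> dual_cone ip K u ->
    dual_cone ip (expface ip K u) y ->
  exists p q, [/\ y = p + q, dual_cone ip K p & orth ip (expface ip K u) q].
Proof.
move=> [[Kcl _ _] Knice] Kcc uK yE; set E := expface ip K u in yE *.
pose M := [set p + q | p in dual_cone ip K & q in orth ip E].
have [D0 DD DZ] := dual_convex_cone ip K; have [O0 OD OZ] := orth_cone E.
have Mcc : convex_cone M.
  split; first by exists 0 => //; exists 0; rewrite ?addr0.
    move=> _ _ [p pK [q qE <-]] [p' p'K [q' q'E <-]].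
    exists (p + p'); first exact: DD.
    by exists (q + q'); [exact: OD | rewrite addrACA].
  move=> t _ t0 [p pK [q qE <-]]; exists (t *: p); first exact: DZ.
  by exists (t *: q); [exact: OZ | rewrite scalerDr].
suff [p pK [q qE <-]] : M y by exists p, q.
apply: contrapT => /(separation (Knice E (expface_face Kcc uK)) Mcc)[z zM].
have Kz : K z.
  apply: (bipolar Kcl Kcc) => k kK; apply: zM.
  by exists k => //; exists 0; rewrite ?addr0.
have uE : orth ip E u by apply/orthP => x [].
have zu : ip u z = 0.
  have /zM : M u by exists 0 => //; exists u; rewrite ?add0r.
  have /zM : M (- u).
    exists 0 => //; exists (- u); rewrite ?add0r //.
    by apply/orthP => x Ex; rewrite ipNl; have /orthP -> := uE; rewrite ?oppr0.
  by rewrite ipNr (ipC ip z u); lra.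
by rewrite ipC ltNge yE.
Qed.

End NiceCones.

(** * The extended dual over a nice cone *)

Section NiceDuality.
Context (R : realType) (X Y : vectType R).
Context (ipX : {dot X for idfun}) (ipY : {dot Y for idfun}).
Context (A : 'Hom(X, Y)) (As : 'Hom(Y, X)) (b : Y) (K : set Y).
Context (A_adj : is_adjoint ipX ipY A As) (K_nice : nice ipY K).

Let L := Lspace ipY As b.

Lemma mem_Lspace (y : Y) : y \in L <->
  [/\ y \in (fullv : {vspace Y}), forall x, ipY y (A x) = 0 & ipY y b = 0].
Proof.
rewrite memv_cap memv_ker; split.
  move=> /andP[/eqP Asy /mem_orthovP yb]; split; rewrite ?memvf //.
    by move=> x; rewrite ipC A_adj Asy ip0r.
  by apply: yb; exact: memv_line.
move=> [_ yA yb]; apply/andP; split.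
  by apply/eqP/(@ip_eq0 _ _ ipX); rewrite -A_adj ipC yA.
by rewrite mem_orthov1; apply/eqP.
Qed.

Lemma chain_bound lK : longest_face_chain K lK -> convex_cone K ->
  forall u : nat -> Y,
    (forall i, (i <= (lK - 1).+1)%N ->
       u i \in (fullv : {vspace Y}) /\ dual_cone ipY K (u i)) ->
  ~ (forall i, (i <= lK - 1)%N ->
       expface ipY K (u i.+1) `<` expface ipY K (u i)).
Proof.
move=> [_ lK_max] Kcc u uK strict; have [K0 _ _] := Kcc.
have K_face : face K K by split=> //; exact: convex_cone_convex.
(* The chain consisting of [K] alone; thus the subtraction in [lK - 1] does not truncate. *)
have lK_gt0 : (0 < lK)%N.
  by apply: lK_max; exists (fun=> K); split=> // i _; split=> //; exists 0.
suff /lK_max : face_chain K lK.+1 by rewrite ltnn.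
(* The [lK + 1] decreasing faces of [u 0], ..., [u lK], listed backwards. *)
exists (fun i => expface ipY K (u (lK - i)%N)); split=> i ilK.
  split.
    apply: expface_face => //; apply: (uK _ _).2.
    by rewrite subn1 prednK // leq_subr.
  by have [E0 _ _] := expface_cone ipY (u (lK - i)%N) Kcc; exists 0.
rewrite ltnS in ilK.
have := strict (lK - i.+1)%N; rewrite -subSn // subSS; apply.
by rewrite leq_sub2l.
Qed.


(** Prolonging the segment from [x1] beyond [xb] within the feasible set shows, by [face_absorb],
    that [F] contains the slack of [x1]. Each face then contains an interior point of the other, and
    absorption gives both inclusions. *)
Lemma minimal_cone_expface (F : set Y) u x1 : convex_cone K ->
    dual_cone ipY K u -> minimal_cone ipX ipY A b K F ->
    (forall x, K (b - A x) -> expface ipY K u (b - A x)) ->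
    cone_core (expface ipY K u) (b - A x1) ->
  F = expface ipY K u.
Proof.
move=> Kcc uK [F_face [xb xbP sbP]] slackE [E1 coreP].
have [FK _ _] := F_face; have Fsb := sbP.1.
have [E0 ED EZ] := expface_cone ipY u Kcc.
have Fs1 : F (b - A x1).
  have [|e e0 Kx] := relint_extend xbP (y := x1); first exact: E1.1.
  apply: (face_absorb F_face Fsb E1.1 e0).
  move: Kx; rewrite /primal_feasible /= linearD linearZ linearB /=.
  have -> : b - A xb - (b - A x1) = - (A xb - A x1).
    by rewrite opprB addrC subrKA opprB.
  by rewrite scalerN opprD addrA.
apply/seteqP; split=> f Ff.
  have [e e0 Fe] := relint_extend sbP Ff.
  apply: (face_absorb (expface_face Kcc uK) (slackE _ (FK _ Fsb)) (FK _ Ff) e0).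
  exact: FK.
have [e e0 Ee] := coreP _ Ff.
apply: (face_absorb F_face Fs1 (expface_sub Ff) e0).
apply: expface_sub; rewrite scalerBr addrCA; apply: ED => //.
by apply: EZ => //; exact: ltW.
Qed.

Context (lK : nat) (K_chain : longest_face_chain K lK).
Context (F : set Y) (F_min : minimal_cone ipX ipY A b K F).
Context (P_feasible : primal_feasible A b K !=set0).

Let ell := minn (lK - 1) (\dim L).

Lemma nice_cone_convex : convex_cone K.
Proof.
have [[_ Kcv Khc] _] := K_nice; have [x Kx] := P_feasible.
by apply: convex_cone_of_convex => //; exists (b - A x).
Qed.

Lemma ext_nice_simpleE (u v : nat -> Y) : ext_nice_simple ipY K L ell u v <->
  reduction ipY K fullv L ell u v /\
  dual_pair ipY K fullv (u ell) (u ell.+1) (v ell.+1).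
Proof.
have Kcc := nice_cone_convex; have [[Kcl _ _] _] := K_nice.
have dual0 : dual_cone ipY K 0 by move=> x _; rewrite ip0l.
split=> [[[u0 v0] uvK uvL]|[[u0 v0 uvP] uvE]].
  have pair_ok i : (i <= ell)%N -> dual_pair ipY K fullv (u i) (u i.+1) (v i.+1).
    move=> il; have [uK vT] := uvK i.+1 il.
    split; rewrite ?memvf //; move: vT; rewrite tan_dual //=.
    by case: i il {uK} => [|i] il; [rewrite u0 | have [] := uvK i.+1 (ltnW il)].
  split; last exact: pair_ok.
  by split=> // i il; split; [exact/pair_ok/ltnW | exact: uvL].
have pair_ok i : (i <= ell)%N -> dual_pair ipY K fullv (u i) (u i.+1) (v i.+1).
  by rewrite leq_eqVlt => /predU1P[->//|/uvP[]].
have uK i : (i <= ell.+1)%N -> dual_cone ipY K (u i).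
  by case: i => [|i] il; [rewrite u0 | have [] := pair_ok i il].
split=> // [[|i] // il|[|i] // il]; last by have [] := uvP i il.
have [_ ? _ vO] := pair_ok i il.
by split=> //=; rewrite tan_dual //; exact/uK/ltnW.
Qed.

Theorem nice_extended_dual (c : X) :
  dual_cone ipY F = [set y | exists u v : nat -> Y,
    ext_nice_simple ipY K L ell u v /\ y = u ell.+1 + v ell.+1] /\
  strong_duality (primal_values ipX A b c K)
                 (ext_dual_values ipY As b c K L ell).
Proof.
have Kcc := nice_cone_convex; have [x0 Kx0] := P_feasible.
have S_proj y : exists y', [/\ y' \in (fullv : {vspace Y}),
    forall k, K k -> ipY y' k = ipY y k & forall x, ipY y' (A x) = ipY y (A x)].
  by exists y; rewrite memvf.
have dual_split u y : u \in (fullv : {vspace Y}) -> dual_cone ipY K u ->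
    y \in (fullv : {vspace Y}) -> dual_cone ipY (expface ipY K u) y ->
    exists u' v', y = u' + v' /\ dual_pair ipY K fullv u u' v'.
  move=> _ uK _ /(nice_dual_split K_nice Kcc uK)[p [q [-> pK qE]]].
  by exists p, q; split=> //; split; rewrite ?memvf.
have ell_bound : (\dim L <= ell)%N \/ forall u : nat -> Y,
    (forall i, (i <= ell.+1)%N ->
       u i \in (fullv : {vspace Y}) /\ dual_cone ipY K (u i)) ->
    ~ (forall i, (i <= ell)%N -> expface ipY K (u i.+1) `<` expface ipY K (u i)).
  (* The number of steps is bounded by chains of faces or by the dimension of [L], according to
     which one attains the minimum. *)
  rewrite /ell; have [_|_] := leqP (lK - 1) (\dim L); last by left.
  by right; exact: chain_bound.
have [u [v [red _ uK [x1 core_x1]]]] :=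
  facial_reduction Kcc S_proj mem_Lspace dual_split ell_bound Kx0.
have slackE x : K (b - A x) -> expface ipY K (u ell) (b - A x).
  by move=> Kx; exact: (reduction_slack mem_Lspace red Kx).
have FE := minimal_cone_expface Kcc uK F_min slackE core_x1.
have dualE y : dual_cone ipY F y <-> exists u v : nat -> Y,
    ext_nice_simple ipY K L ell u v /\ y = u ell.+1 + v ell.+1.
  have := @dual_expfaceE _ _ ipY _ A b K fullv L ell mem_Lspace dual_split
    (u ell) (memvf _) uK (ex_intro _ u (ex_intro _ v (conj red erefl)))
    (ex_intro _ x1 core_x1) y.
  rewrite -FE memvf => -[H1 H2]; split.
    move=> yF; have [u' [v' [red' pair' ->]]] := H1 (conj isT yF).
    by exists u', v'; split=> //; apply/ext_nice_simpleE.
  move=> [u' [v' [/ext_nice_simpleE[red' pair'] y_eq]]].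
  by have [] // : true /\ dual_cone ipY F y by apply: H2; exists u', v'.
split; first by apply/seteqP; split=> y /dualE.
have := @core_strong_duality _ _ ipY _ A b K fullv S_proj x0 Kx0
  (expface ipY K (u ell)) (ipX c) x1 (expface_cone _ _ Kcc) (@expface_sub _ _ _ _ _)
  core_x1 slackE.
rewrite -FE; congr strong_duality.
apply/seteqP; split=> d.
  move=> [y [_ /dualE[u' [v' [uv' y_eq]]] yA] <-]; exists u', v'.
  split=> //; last by rewrite -y_eq.
  rewrite -y_eq; apply/eqP; rewrite -subr_eq0; apply/eqP/(@ip_eq0 _ _ ipX).
  set w := _ - _; rewrite {1}/w ipDl ipNl -yA.
  by rewrite (ipC ipX) -A_adj (ipC ipY) subrr.
move=> [u' [v' [Asy uv' ->]]]; exists (u' ell.+1 + v' ell.+1) => //.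
split; [exact: memvf | by apply/dualE; exists u', v' |].
by move=> x; rewrite ipC A_adj Asy ipC.
Qed.

End NiceDuality.

(** * Positive semidefinite matrices *)

Section MatrixInnerProduct.
Context (R : realType) (n : nat).
Implicit Types (x y z u w : 'M[R]_n) (h k : 'cV[R]_n).

Lemma mxipE x z : mxip x z = \tr (x^T *m z).
Proof.
rewrite /mxip /mxtrace exchange_big; apply: eq_bigr => i _ /=.
by rewrite mxE; apply: eq_bigr => j _; rewrite mxE.
Qed.

Lemma mxip_sym x z : mxip x z = mxip z x.
Proof. by rewrite !mxipE -mxtrace_tr trmx_mul trmxK. Qed.

Lemma mxip_linear x : scalar (mxip x).
Proof. by move=> t y z; rewrite !mxipE mulmxDr -scalemxAr mxtraceD mxtraceZ. Qed.

Lemma mxip_pos x : x != 0 -> 0 < mxip x x.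
Proof.
move=> x0; rewrite lt_def; apply/andP; split; last first.
  by apply: sumr_ge0 => i _; apply: sumr_ge0 => j _; rewrite -expr2 sqr_ge0.
apply: contra_neq x0 => /eqP.
rewrite psumr_eq0 => [/allP xx|i _]; last first.
  by apply: sumr_ge0 => j _; rewrite -expr2 sqr_ge0.
apply/matrixP => i j; rewrite mxE; have := xx i; rewrite mem_index_enum => /(_ isT).
rewrite psumr_eq0 => [/allP xij|k _]; last by rewrite -expr2 sqr_ge0.
by have := xij j; rewrite mem_index_enum => /(_ isT); rewrite mulf_eq0 orbb => /eqP.
Qed.

Fact mxip_bilinear : bilinear_for
  (GRing.Scale.Law.clone _ _ *%R _) (GRing.Scale.Law.clone _ _ (idfun \; *%R) _)
  (@mxip R n).
Proof.
split=> [x t y z|x t y z] /=; last exact: mxip_linear.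
by rewrite ![mxip _ x]mxip_sym; exact: mxip_linear.
Qed.

HB.instance Definition _ := bilinear_isBilinear.Build R 'M[R]_n 'M[R]_n R
  _ _ (@mxip R n) mxip_bilinear.

Fact mxip_hermitian x y : mxip x y = (-1) ^+ false * idfun (mxip y x).
Proof. by rewrite expr0 mul1r mxip_sym. Qed.

HB.instance Definition _ :=
  isHermitianSesquilinear.Build R 'M[R]_n false idfun (@mxip R n) mxip_hermitian.

HB.instance Definition _ := isDotProduct.Build R 'M[R]_n (@mxip R n) mxip_pos.

Definition mxdot : {dot 'M[R]_n for idfun} := @mxip R n.

Lemma mxdotE x z : mxdot x z = mxip x z.
Proof. by []. Qed.

Lemma mxip_tr x z : mxip x^T z^T = mxip x z.
Proof. by rewrite !mxipE trmxK mxtrace_mulC -mxtrace_tr trmx_mul trmxK. Qed.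

End MatrixInnerProduct.

Section Psd.
Context (R : realType).

Definition qform n (y : 'M[R]_n) (h k : 'cV[R]_n) : R := (h^T *m y *m k) 0 0.

Section QForm.
Context (n : nat).
Implicit Types (x y z u w : 'M[R]_n) (h k : 'cV[R]_n).

Lemma qformDr y h k k' : qform y h (k + k') = qform y h k + qform y h k'.
Proof. by rewrite /qform mulmxDr mxE. Qed.

Lemma qformDl y h h' k : qform y (h + h') k = qform y h k + qform y h' k.
Proof. by rewrite /qform linearD /= !mulmxDl mxE. Qed.

Lemma qformZr y t h k : qform y h (t *: k) = t * qform y h k.
Proof. by rewrite /qform -scalemxAr mxE. Qed.

Lemma qformZl y t h k : qform y (t *: h) k = t * qform y h k.
Proof. by rewrite /qform linearZ /= -!scalemxAl mxE. Qed.

Lemma qform_tr y h k : qform y^T h k = qform y k h.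
Proof.
have trE (M : 'M[R]_1) : M 0 0 = M^T 0 0 by rewrite mxE.
by rewrite /qform trE !trmx_mul !trmxK mulmxA.
Qed.

Lemma qformDm y z h k : qform (y + z) h k = qform y h k + qform z h k.
Proof. by rewrite /qform mulmxDr mulmxDl mxE. Qed.

Lemma qformNm y h k : qform (- y) h k = - qform y h k.
Proof. by rewrite /qform mulmxN mulNmx mxE. Qed.

Lemma qform_delta y i j : qform y (delta_mx i 0) (delta_mx j 0) = y i j.
Proof. by rewrite /qform trmx_delta -rowE -colE !mxE. Qed.

Lemma qform_eq0 y k : (forall h, qform y h k = 0) -> y *m k = 0.
Proof.
move=> yk; apply/matrixP => i j; rewrite ord1 [RHS]mxE.
by have := yk (delta_mx i 0); rewrite /qform trmx_delta -mulmxA -rowE mxE.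
Qed.

Lemma mxip_outer y h : mxip y (h *m h^T) = qform y h h.
Proof.
by rewrite mxipE mulmxA mxtrace_mulC mulmxA -[RHS]qform_tr /mxtrace big_ord1.
Qed.

Lemma psd_sym y h k : psdmx y -> qform y h k = qform y k h.
Proof. by move=> [ysym _]; rewrite -{1}ysym qform_tr. Qed.

Lemma qform_outer h k : qform (h *m h^T) k k = (k^T *m h) 0 0 ^+ 2.
Proof.
rewrite /qform mulmxA -mulmxA mxE big_ord1 expr2; congr (_ * _).
have -> : (h^T *m k) 0 0 = (h^T *m k)^T 0 0 by rewrite [RHS]mxE.
by rewrite trmx_mul trmxK.
Qed.

Lemma psd_outer h : psdmx (h *m h^T).
Proof.
split=> [|k]; first by rewrite trmx_mul trmxK.
by rewrite -/(qform _ _ _) qform_outer sqr_ge0.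
Qed.

(** Nonnegativity of the form at [t *: k + h] leaves no negative linear term in [t]; replacing [k]
    by [- k] makes that term vanish. *)
Lemma psd_ker y h : psdmx y -> qform y h h = 0 -> y *m h = 0.
Proof.
move=> ypsd yhh; suff H k : 0 <= qform y k h.
  apply: qform_eq0 => k; apply/eqP; rewrite eq_le H andbT.
  by have := H (- k); rewrite -scaleN1r qformZl mulN1r oppr_ge0.
suff : 0 <= 2 * qform y k h by lra.
apply: (@ge0_of_quadratic _ _ (qform y k k)) => t _.
have := ypsd.2 (t *: k + h); rewrite -/(qform _ _ _).
rewrite !qformDr !qformDl !qformZr !qformZl yhh (psd_sym h k ypsd).
by move=> H; apply: le_trans H _; rewrite le_eqVlt; apply/orP; left; apply/eqP; ring.
Qed.

Lemma psd_cone : convex_cone (@psdmx R n).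
Proof.
split.
- split=> [|h]; first by rewrite trmx0.
  by rewrite mulmx0 mul0mx mxE.
- move=> x y [xs xp] [ys yp]; split=> [|h]; first by rewrite linearD /= xs ys.
  by rewrite mulmxDr mulmxDl mxE addr_ge0.
- move=> t x t0 [xs xp]; split=> [|h]; first by rewrite linearZ /= xs.
  by rewrite -scalemxAr -scalemxAl mxE mulr_ge0.
Qed.

(* Cholesky: subtracting from [x] the outer square of its normalized [j]-th
   column annihilates the [j]-th diagonal entry and keeps the null ones. *)
Lemma psd_sum_outer x : psdmx x ->
  exists s : seq 'cV[R]_n, x = \sum_(h <- s) h *m h^T.
Proof.
have [d] := ubnP #|[pred i | x i i != 0]|; elim: d x => // d IH x xd xpsd.
have [/existsP[j xj]|/existsPn x0] := boolP [exists i, x i i != 0]; last first.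
  exists [::]; rewrite big_nil; apply/matrixP => i j.
  have xj : qform x (delta_mx j 0) (delta_mx j 0) = 0.
    by rewrite qform_delta; have := x0 j; rewrite negbK => /eqP.
  have := psd_ker xpsd xj; rewrite -colE => /matrixP/(_ i 0).
  by rewrite !mxE.
have diag_ge0 y i : psdmx y -> 0 <= y i i.
  by move=> [_ /(_ (delta_mx i 0))]; rewrite -/(qform _ _ _) qform_delta.
have xj_gt0 : 0 < x j j by rewrite lt_def xj diag_ge0.
pose h := (Num.sqrt (x j j))^-1 *: col j x; pose x' := x - h *m h^T.
have qform_h k : qform (h *m h^T) k k = qform x k (delta_mx j 0) ^+ 2 / x j j.
  rewrite qform_outer /h -scalemxAr mxE colE mulmxA exprMn exprVn.
  by rewrite sqr_sqrtr ?ltW // mulrC.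
have x'_psd : psdmx x'.
  split=> [|k]; first by rewrite linearB /= trmx_mul trmxK xpsd.1.
  rewrite -/(qform _ _ _) qformDm qformNm qform_h.
  (* At this vector the form of [x] is [x j j ^+ 2] times that of [x'] at [k]. *)
  have := xpsd.2 (x j j *: k - qform x k (delta_mx j 0) *: delta_mx j 0).
  rewrite -/(qform _ _ _) -scaleNr !qformDr !qformDl !qformZr !qformZl.
  rewrite qform_delta (psd_sym (delta_mx j 0) k xpsd).
  set c := qform x k (delta_mx j 0); set q := qform x k k; set p := x j j in xj_gt0 *.
  move=> H; suff : 0 <= p * (p * (q - c ^+ 2 / p)) by rewrite !pmulr_rge0.
  apply: le_trans H _; rewrite le_eqVlt; apply/orP; left; apply/eqP; field.
  by rewrite gt_eqF.
have x'_diag i : x' i i = x i i - x i j ^+ 2 / x j j.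
  rewrite -[LHS]qform_delta qformDm qformNm qform_h !qform_delta.
  by [].
have [|//|s x'E] := IH x'; last first.
  by exists (h :: s); rewrite big_cons -x'E /x' addrC subrK.
rewrite -ltnS; apply: leq_trans xd; rewrite ltnS.
apply: proper_card; apply/properP; split; last first.
  exists j; rewrite !inE // x'_diag negbK; apply/eqP; field; by rewrite gt_eqF.
apply/fintype.subsetP => i; rewrite !inE; apply: contraNneq => xi.
rewrite eq_le diag_ge0 // andbT x'_diag xi sub0r oppr_le0.
by rewrite divr_ge0 ?sqr_ge0 ?ltW.
Qed.

End QForm.

(** * Faces and tangent spaces of the psd cone *)

Section PsdFaces.
Context (n : nat).
Implicit Types (x y z u w : 'M[R]_n) (h k : 'cV[R]_n).

Lemma psd_mxip_ge0 u x : psdmx u -> psdmx x -> 0 <= mxip u x.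
Proof.
move=> upsd /psd_sum_outer[s ->]; rewrite (ip_sumr (@mxdot R n)) sumr_ge0 // => h _.
by rewrite /= ?mxdotE mxip_outer; apply: upsd.2.
Qed.

(** In the space of all matrices the dual cone also contains the skew ones, hence the restriction to
    symmetric [u]. *)
Lemma dual_psd u : u^T = u ->
  (dual_cone (@mxdot R n) (@psdmx R n) u <-> psdmx u).
Proof.
move=> usym; split=> [uK|upsd x xpsd]; last exact: psd_mxip_ge0.
by split=> // h; have := uK _ (psd_outer h); rewrite /= ?mxdotE mxip_outer.
Qed.

Lemma expface_outer u h : u *m h = 0 ->
  expface (@mxdot R n) (@psdmx R n) u (h *m h^T).
Proof.
move=> uh; split; first exact: psd_outer.
by rewrite /= ?mxdotE mxip_outer /qform -mulmxA uh mulmx0 mxE.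
Qed.

Lemma expface_psd_sum u x : psdmx u -> expface (@mxdot R n) (@psdmx R n) u x ->
  exists2 s : seq 'cV[R]_n, x = \sum_(h <- s) h *m h^T
    & {in s, forall h, u *m h = 0}.
Proof.
move=> upsd [/psd_sum_outer[s ->]]; rewrite /= (ip_sumr (@mxdot R n)) => /eqP.
rewrite psumr_eq0 => [/allP us|h _]; last first.
  by rewrite /= ?mxdotE mxip_outer; apply: upsd.2.
exists s => // h /us /=; rewrite mxip_outer => /eqP; exact: psd_ker.
Qed.

Lemma block_qform u w (beta : R) h k :
  ((col_mx h k)^T *m block_mx u w w^T beta%:M *m col_mx h k) 0 0
    = qform u h h + 2 * qform w h k + beta * (k^T *m k) 0 0.
Proof.
rewrite tr_col_mx mul_row_block mul_row_col !mulmxDl mul_mx_scalar -scalemxAl.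
have addE (M N : 'M[R]_1) : (M + N) 0 0 = M 0 0 + N 0 0 by rewrite mxE.
have scaleE t (M : 'M[R]_1) : (t *: M) 0 0 = t * M 0 0 by rewrite mxE.
rewrite !addE scaleE -!/(qform _ _ _) (qform_tr w k h).
by ring.
Qed.

Lemma block_tr u w (beta : R) : u^T = u ->
  (block_mx u w w^T beta%:M)^T = block_mx u w w^T beta%:M.
Proof. by move=> usym; rewrite tr_block_mx usym trmxK tr_scalar_mx. Qed.

(** For [h] in the kernel of [u], [col_mx h 0] is isotropic for the block matrix, hence in its
    kernel, so [w^T *m h = 0]; the face is generated by the products [h *m h^T]. *)
Lemma block_psd_orth u w beta : psdmx u -> psdmx (block_mx u w w^T beta%:M) ->
  orth (@mxdot R n) (expface (@mxdot R n) (@psdmx R n) u) (w + w^T).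
Proof.
move=> upsd bpsd; apply/orthP => x /(expface_psd_sum upsd)[s -> us].
rewrite ip_sumr big_seq big1 // => h hs; rewrite /= ?mxdotE mxip_outer qformDm qform_tr.
have uh := us h hs.
have w_h : w^T *m h = 0.
  have : block_mx u w w^T beta%:M *m col_mx h 0 = 0.
    apply: psd_ker => //; rewrite [LHS]block_qform trmx0 mul0mx mxE mulr0.
    by rewrite /qform mulmx0 -mulmxA uh mulmx0 mxE mulr0 !addr0.
  rewrite mul_block_col !mulmx0 !addr0 uh => /(congr1 dsubmx).
  by rewrite col_mxKd linear0.
by rewrite -qform_tr /qform -mulmxA w_h mulmx0 mxE addr0.
Qed.

Lemma qform_bounded y : exists2 beta : R, 0 <= beta
  & forall k, qform y k k <= beta * (k^T *m k) 0 0.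
Proof.
exists (\sum_i \sum_j `|y i j|) => [|k].
  by apply: sumr_ge0 => i _; apply: sumr_ge0.
have nE : (k^T *m k) 0 0 = \sum_i k i 0 ^+ 2.
  by rewrite mxE; apply: eq_bigr => i _; rewrite mxE expr2.
have k_le i : k i 0 ^+ 2 <= (k^T *m k) 0 0.
  by rewrite nE (bigD1 i) //= lerDl sumr_ge0 // => j _; rewrite sqr_ge0.
have -> : qform y k k = \sum_i \sum_j y i j * (k i 0 * k j 0).
  rewrite /qform -mulmxA mxE; apply: eq_bigr => i _.
  by rewrite !mxE mulr_sumr; apply: eq_bigr => j _; ring.
rewrite mulr_suml; apply: ler_sum => i _; rewrite mulr_suml; apply: ler_sum => j _.
apply: le_trans (ler_norm _) _; rewrite normrM ler_wpM2l //.
have ki := k_le i; have kj := k_le j.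
have := sqr_ge0 (k i 0 - k j 0); have := sqr_ge0 (k i 0 + k j 0).
by rewrite ler_norml => H1 H2; apply/andP; split; nra.
Qed.

(** Completing the square: the block form at [(h, k)] is that of [u] at [h + g *m k], minus that of
    [g^T *m u *m g] at [k], plus [beta] times the square norm of [k]. *)
Lemma block_psd u (g : 'M[R]_n) : psdmx u ->
  exists beta, psdmx (block_mx u (u *m g) (u *m g)^T beta%:M).
Proof.
move=> upsd; have [beta _ betaP] := qform_bounded (g^T *m u *m g).
exists beta; split; first exact: block_tr upsd.1.
move=> hk; rewrite -[hk]vsubmxK block_qform.
set h := usubmx hk; set k := dsubmx hk.
have := upsd.2 (h + g *m k); rewrite -/(qform _ _ _) qformDr !qformDl.
have -> : qform u h (g *m k) = qform (u *m g) h k by rewrite /qform !mulmxA.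
have -> : qform u (g *m k) h = qform (u *m g) h k.
  by rewrite (psd_sym _ _ upsd) /qform !mulmxA.
have -> : qform u (g *m k) (g *m k) = qform (g^T *m u *m g) k k.
  by rewrite /qform trmx_mul !mulmxA.
by have := betaP k; lra.
Qed.

Lemma gram_unit r (N : 'M[R]_(r, n)) : row_free N -> N *m N^T \in unitmx.
Proof.
move=> Nfree; rewrite -row_free_unit -kermx_eq0; apply/eqP/row_matrixP => i.
rewrite row0; set v := row i _.
have vN : v *m (N *m N^T) = 0 by apply/sub_kermxP; exact: row_sub.
have : (v *m N) *m (v *m N)^T = 0 by rewrite trmx_mul mulmxA -(mulmxA v) vN mul0mx.
move=> /matrixP/(_ 0 0); rewrite !mxE => /eqP; rewrite psumr_eq0; last first.
  by move=> j _; rewrite [_^T _ _]mxE -expr2 sqr_ge0.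
move=> /allP vN0; have : v *m N = 0.
  apply/matrixP => a j; rewrite ord1 [RHS]mxE.
  by have := vN0 j; rewrite mem_index_enum [_^T _ _]mxE mulf_eq0 orbb => /(_ isT)/eqP.
move/eqP; rewrite -(mul0mx _ N) => /eqP; exact: row_free_inj.
Qed.

(* [Q] is the orthogonal projection onto the kernel of [u]. *)
Lemma kernel_projection u : u^T = u ->
  exists Q z, [/\ u *m Q = 0, Q^T = Q & 1%:M - Q = u *m z].
Proof.
move=> usym.
have [r [N [N_free N_ker]]] : exists r (N : 'M[R]_(r, n)),
    row_free N /\ (N :=: kermx u)%MS.
  by exists _, (row_base (kermx u)); split; [exact: row_base_free | exact: eq_row_base].
pose G := N *m N^T; have Gunit : G \in unitmx by exact: gram_unit.
have Nu : N *m u = 0 by apply/sub_kermxP; rewrite N_ker.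
have uN : u *m N^T = 0 by rewrite -[LHS]trmxK trmx_mul trmxK usym Nu trmx0.
pose Q := N^T *m invmx G *m N.
have Qsym : Q^T = Q.
  have Gsym : G^T = G by rewrite trmx_mul trmxK.
  by rewrite /Q !trmx_mul trmxK trmx_inv Gsym mulmxA.
(* By symmetry the columns of the cokernel of [u] are in its kernel, so [1 - Q] kills them and its
   rows lie in the row space of [u]. *)
have /submxP[D cokerE] : ((cokermx u)^T <= N)%MS.
  rewrite N_ker; apply/sub_kermxP.
  by rewrite -[LHS]trmxK trmx_mul trmxK usym mulmx_coker trmx0.
have QN : (1%:M - Q) *m N^T = 0.
  by rewrite mulmxBl mul1mx /Q -!mulmxA -/G mulVmx // mulmx1 subrr.
have /submxP[z zE] : (1%:M - Q <= u)%MS.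
  by rewrite submxE -[cokermx u]trmxK cokerE trmx_mul mulmxA QN mul0mx.
exists Q, z^T; split=> //; first by rewrite /Q !mulmxA uN !mul0mx.
by rewrite -[RHS]trmxK trmx_mul trmxK usym -zE linearB /= trmx1 Qsym.
Qed.

(** Here [p = QyQ], which is psd because [Q *m h] is in the kernel of [u]. The last clause serves
    tangent vectors, which thus have the form [w + w^T] alone. *)
Lemma psd_dual_split u y : psdmx u -> y^T = y ->
    dual_cone (@mxdot R n) (expface (@mxdot R n) (@psdmx R n) u) y ->
  exists p w beta, [/\ psdmx p, y = p + (w + w^T),
    psdmx (block_mx u w w^T beta%:M)
    & orth (@mxdot R n) (expface (@mxdot R n) (@psdmx R n) u) y -> p = 0].
Proof.
move=> upsd ysym yE; have [Q [z [uQ Qsym PE]]] := kernel_projection upsd.1.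
pose P : 'M[R]_n := 1%:M - Q.
have Psym : P^T = P by rewrite linearB /= trmx1 Qsym.
have QE : Q = 1%:M - P by rewrite /P subKr.
rewrite -/P in PE; clearbody P.
(* Since [P = u *m z], this gives [u *m g = Py - PyP / 2]; the half compensates for [PyP] occurring
   twice in [w + w^T]. *)
pose g := z *m (y - 2^-1 *: (y *m P)).
have [beta betaP] := block_psd g upsd.
have QyQ h k : qform (Q *m y *m Q) h k = qform y (Q *m h) (Q *m k).
  by rewrite /qform trmx_mul Qsym !mulmxA.
have face_h h : expface (@mxdot R n) (@psdmx R n) u (Q *m h *m (Q *m h)^T).
  by apply: expface_outer; rewrite mulmxA uQ mul0mx.
have QyQsym : (Q *m y *m Q)^T = Q *m y *m Q by rewrite !trmx_mul ysym Qsym mulmxA.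
have QyQpsd : psdmx (Q *m y *m Q).
  split=> // h; rewrite -/(qform _ _ _) QyQ.
  by have := yE _ (face_h h); rewrite /= ?mxdotE mxip_outer.
exists (Q *m y *m Q), (u *m g), beta; split=> // [|/orthP y_orth].
  have ugE : u *m g = P *m y - 2^-1 *: (P *m y *m P).
    by rewrite /g mulmxA -PE mulmxBr -scalemxAr mulmxA.
  have -> : (u *m g)^T = y *m P - 2^-1 *: (P *m y *m P).
    by rewrite ugE linearB linearZ /= !trmx_mul Psym ysym mulmxA.
  rewrite ugE addrACA -opprD -scalerDl.
  have -> : 2^-1 + 2^-1 = 1 :> R by lra.
  rewrite scale1r QE mulmxBl mul1mx mulmxBr mulmx1 mulmxBl.
  by rewrite -[y - _ - _]addrA -opprD -(addrA (P *m y)) subrK.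
have QyQ0 h : Q *m y *m Q *m h = 0.
  by apply: psd_ker => //; rewrite QyQ -mxip_outer; exact: y_orth.
by apply/matrixP => i j; rewrite [RHS]mxE -qform_delta /qform -mulmxA QyQ0 mulmx0 mxE.
Qed.

(** The face is determined by the kernel. Inclusion of faces gives inclusion of kernels, and without
    a gain of rank the kernels, hence the faces, would coincide. *)
Lemma psd_expface_rank u u' : psdmx u -> psdmx u' ->
    expface (@mxdot R n) (@psdmx R n) u' `<` expface (@mxdot R n) (@psdmx R n) u ->
  (\rank u < \rank u')%N.
Proof.
move=> upsd u'psd [sub nsub].
have ker_sub : (kermx u' <= kermx u)%MS.
  apply/rV_subP => v /sub_kermxP vu'; apply/sub_kermxP.
  have u'v : u' *m v^T = 0 by rewrite -[u'](proj1 u'psd) -trmx_mul vu' trmx0.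
  have [_] := sub _ (expface_outer u'v).
  rewrite /= ?mxdotE mxip_outer => /(psd_ker upsd) uv.
  by rewrite -[u](proj1 upsd) -[v]trmxK -trmx_mul uv trmx0.
rewrite ltnNge; apply/negP => rank_le; apply: nsub => x xE.
have ker_sub' : (kermx u <= kermx u')%MS.
  by rewrite -(geq_leqif (mxrank_leqif_sup ker_sub)) !mxrank_ker leq_sub2l.
have [s -> us] := expface_psd_sum upsd xE.
have Ecc := expface_cone (@mxdot R n) u' (psd_cone n).
rewrite big_seq; apply: convex_cone_sum => // h hs; apply: expface_outer.
have : (h^T <= kermx u')%MS.
  apply: submx_trans ker_sub'; apply/sub_kermxP.
  by rewrite -[u](proj1 upsd) -trmx_mul us ?trmx0.
by move=> /sub_kermxP hu'; rewrite -[u'](proj1 u'psd) -[h]trmxK -trmx_mul hu' trmx0.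
Qed.

End PsdFaces.
End Psd.

(** * The dimension of the space of symmetric matrices *)

Section SymmetricMatrices.
Context (R : realType) (n : nat).

Definition symv : {vspace 'M[R]_n} := fixedSpace (linfun (@trmx R n n)).

Lemma mem_symv (y : 'M[R]_n) : (y \in symv) = (y^T == y).
Proof. by apply/fixedSpaceP/eqP; rewrite lfunE. Qed.

(** The numbers of pairs with [i <= j] and with [i < j] have sum [n * n], by transposition, and
    difference [n]. *)
Lemma card_upper_triangle :
  #|[pred p : 'I_n * 'I_n | (p.1 <= p.2)%N]| = ((n * n.+1)./2)%N.
Proof.
pose le := (\sum_(i < n) \sum_(j < n) (i <= j))%N.
pose lt := (\sum_(i < n) \sum_(j < n) (i < j))%N.
have le_lt : (le + lt = n * n)%N.
  rewrite /lt exchange_big /le -big_split /=.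
  transitivity (\sum_(i < n) \sum_(j < n) 1)%N; last first.
    by rewrite !sum_nat_const !card_ord muln1.
  apply: eq_bigr => i _; rewrite -big_split; apply: eq_bigr => j _ /=.
  by rewrite [(j < i)%N]ltnNge; case: (i <= j)%N.
have leE : (le = n + lt)%N.
  have -> : n = (\sum_(i < n) \sum_(j < n) (i == j))%N.
    rewrite -[LHS]card_ord -sum1_card; apply: eq_bigr => i _.
    by rewrite (bigD1 i) //= eqxx big1 // => j /negbTE; rewrite eq_sym => ->.
  rewrite -big_split; apply: eq_bigr => i _; rewrite -big_split; apply: eq_bigr => j _.
  by rewrite leq_eqVlt -val_eqE; case: ltngtP.
rewrite -sum1_card big_mkcond /=.
have -> : (\sum_(p : 'I_n * 'I_n) (if (p.1 <= p.2)%N then 1 else 0) = le)%N.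
  by rewrite /le pair_bigA; apply: eq_bigr => p _; case: leqP.
clearbody le lt; have <- : le.*2 = (n * n.+1)%N by rewrite -addnn mulnS; lia.
by rewrite doubleK.
Qed.

Lemma dim_symv : (\dim symv <= (n * n.+1)./2)%N.
Proof.
pose f (p : 'I_n * 'I_n) : 'M[R]_n := delta_mx p.1 p.2 + delta_mx p.2 p.1.
pose X := [seq f p | p <- enum [pred p : 'I_n * 'I_n | (p.1 <= p.2)%N]].
have : (\dim <<X>> <= (n * n.+1)./2)%N.
  apply: leq_trans (dim_span _) _.
  by rewrite size_map -cardE card_upper_triangle.
apply: leq_trans; apply/dimvS/subvP => y; rewrite mem_symv => /eqP ysym.
(* On the diagonal [f] is twice an elementary matrix, hence the half. *)
pose t (p : 'I_n * 'I_n) : R := if p.1 == p.2 then y p.1 p.2 / 2 else y p.1 p.2.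
have sumE (P : pred ('I_n * 'I_n)) q :
    \sum_(p | P p) t p * (q == p)%:R = if P q then t q else 0.
  case: ifP => Pq; last first.
    by rewrite big1 // => p Pp; case: eqP => [qp|]; rewrite ?mulr0 // qp Pp in Pq *.
  rewrite (bigD1 q) //= eqxx mulr1 big1 ?addr0 // => p /andP[_ /negbTE].
  by rewrite eq_sym => ->; rewrite mulr0.
have -> : y = \sum_(p : 'I_n * 'I_n | (p.1 <= p.2)%N) t p *: f p.
  apply/matrixP => i j; rewrite summxE.
  under eq_bigr => p _.
    rewrite !mxE -[(i == p.1) && _]/((i, j) == p) [(i == p.2) && _]andbC.
    rewrite -[(j == p.1) && _]/((j, i) == p) mulrDr; over.
  rewrite big_split !sumE /t /= [j == i]eq_sym.
  have yji : y j i = y i j by rewrite -[in LHS]ysym mxE.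
  rewrite yji -val_eqE /=; case: ltngtP => [_|_|ij]; rewrite ?addr0 ?add0r //.
  by field.
apply: memv_suml => p pP; apply/memvZ/memv_span/map_f.
by rewrite mem_enum.
Qed.

End SymmetricMatrices.

(** * Semidefinite programs *)

Section SdpDuality.
Context (R : realType) (n m : nat) (a : m.-tuple 'M[R]_n) (b : 'M[R]_n).
Context (a_sym : forall i, (tnth a i)^T = tnth a i) (b_sym : b^T = b).

Fact sdp_map_linear : linear (sdp_map a).
Proof.
move=> t x y; rewrite /sdp_map scaler_sumr -big_split; apply: eq_bigr => i _ /=.
by rewrite !mxE scalerDl scalerA.
Qed.

HB.instance Definition _ :=
  GRing.isLinear.Build R 'rV[R]_m 'M[R]_n *:%R (sdp_map a) sdp_map_linear.

Definition rv_form (c x : 'rV[R]_m) : R := \sum_i c 0 i * x 0 i.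

Fact rv_form_linear c : scalar (rv_form c).
Proof.
move=> t x y; rewrite /rv_form mulr_sumr -big_split; apply: eq_bigr => i _ /=.
by rewrite !mxE; ring.
Qed.

HB.instance Definition _ c :=
  GRing.isLinear.Build R 'rV[R]_m R *%R (rv_form c) (rv_form_linear c).

Local Notation ip := (@mxdot R n).
Local Notation K := (@psdmx R n).
Local Notation S := (symv R n).

Lemma sdp_map_delta j : sdp_map a (delta_mx 0 j) = tnth a j.
Proof.
rewrite /sdp_map (bigD1 j) //= !mxE !eqxx scale1r big1 ?addr0 // => i ij.
by rewrite !mxE (negbTE ij) andbF scale0r.
Qed.

Lemma sdp_adjE y x : ip y (sdp_map a x) = rv_form (sdp_adj a y) x.
Proof.
rewrite ip_sumr; apply: eq_bigr => i _.
by rewrite ipZr mxE mulrC /= ?mxdotE mxip_sym.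
Qed.

Lemma sdp_adjP y c : sdp_adj a y = c <-> forall x, ip y (sdp_map a x) = rv_form c x.
Proof.
split=> [<- x|yc]; first exact: sdp_adjE.
apply/rowP => j; have := yc (delta_mx 0 j); rewrite sdp_adjE /rv_form.
rewrite (bigD1 j) //= [in X in _ = X -> _](bigD1 j) //= !big1 => [|i ij|i ij].
- by rewrite ![delta_mx _ _ _ _]mxE !eqxx !mulr1 !addr0.
- by rewrite [delta_mx _ _ _ _]mxE (negbTE ij) andbF mulr0.
- by rewrite [delta_mx _ _ _ _]mxE (negbTE ij) andbF mulr0.
Qed.

Lemma sdp_map_sym x : (sdp_map a x)^T = sdp_map a x.
Proof.
rewrite /sdp_map linear_sum; apply: eq_bigr => i _.
by rewrite linearZ /= a_sym.
Qed.

Lemma sym_proj y : exists y', [/\ y' \in S, forall k, K k -> ip y' k = ip y k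
  & forall x, ip y' (sdp_map a x) = ip y (sdp_map a x)].
Proof.
pose y' := 2^-1 *: (y + y^T).
have y'E z : z^T = z -> ip y' z = ip y z.
  move=> zsym; rewrite ipZl ipDl.
  have -> : ip y^T z = ip y z by rewrite -[in LHS]zsym /= ?mxdotE mxip_tr.
  lra.
exists y'; split=> [|k [ksym _]|x]; last 2 first; [exact: y'E | exact/y'E/sdp_map_sym |].
by rewrite mem_symv linearZ linearD /= trmxK addrC.
Qed.

Definition sdpL : {vspace 'M[R]_n} := (S :&: orthov ip <<b :: a>>)%VS.

Lemma mem_sdpL y : y \in sdpL <->
  [/\ y \in S, forall x, ip y (sdp_map a x) = 0 & ip y b = 0].
Proof.
rewrite memv_cap; split.
  move=> /andP[Sy /mem_orthovP yP]; split=> // [x|]; last first.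
    by apply: yP; rewrite memv_span ?mem_head.
  rewrite ip_sumr big1 // => i _; rewrite ipZr.
  have -> : ip y (tnth a i) = 0; last by rewrite mulr0.
  by apply: yP; rewrite memv_span // inE mem_tnth orbT.
move=> [Sy yA yb]; rewrite Sy; apply/mem_orthovP => v vP.
change (ip y v = 0); rewrite (@coord_span _ _ _ (in_tuple (b :: a)) _ vP) ip_sumr.
rewrite big1 // => i _; rewrite ipZr.
have : (in_tuple (b :: a))`_i \in b :: a by exact: mem_nth.
rewrite inE => /predU1P[->|/tnthP[j ->]]; first by rewrite yb mulr0.
by rewrite -sdp_map_delta yA mulr0.
Qed.

(** The two spaces are orthogonal, so their sum is direct, and it consists of symmetric matrices. *)
Lemma dim_sdpL : (\dim sdpL + \dim <<b :: a>> <= (n * n.+1)./2)%N.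
Proof.
apply: leq_trans (dim_symv R n); rewrite -dimv_disjoint_sum.
  apply: dimvS; rewrite subv_add capvSl; apply/span_subvP => x.
  by rewrite mem_symv inE => /predU1P[->|/tnthP[j ->]]; apply/eqP.
apply/eqP; rewrite -subv0; apply/subvP => y; rewrite memv_cap memv0 => /andP[].
move=> /[1!memv_cap] /andP[_ /mem_orthovP yP] yab.
by apply/eqP/(@ip_eq0 _ _ ip); apply: yP.
Qed.

(** If the minimum is [n], then [n + 1] strict inclusions would force a rank above [n]. Otherwise
    [dim_sdpL] applies, the span of [b :: a] having dimension at least [m], and [m + 1] when [b] is
    outside the span of [a]. *)
Lemma sdp_length_bound : free a ->
  (\dim sdpL <= sdp_length a b)%N \/ forall u : nat -> 'M[R]_n,
  (forall i, (i <= (sdp_length a b).+1)%N -> u i \in S /\ dual_cone ip K (u i)) ->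
  ~ (forall i, (i <= sdp_length a b)%N -> expface ip K (u i.+1) `<` expface ip K (u i)).
Proof.
move=> a_free; have dimL := dim_sdpL.
suff [|->] : (\dim sdpL <= sdp_length a b)%N \/ sdp_length a b = n; [by left | right|].
  move=> u uK strict.
  have rank_ge i : (i <= n.+1)%N -> (i <= \rank (u i))%N.
    elim: i => // i IH iln; apply: leq_ltn_trans (IH (ltnW iln)) _.
    have u_psd j : (j <= n.+1)%N -> psdmx (u j).
      by move=> /uK[/[!mem_symv]/eqP usym /(dual_psd usym)].
    by apply: psd_expface_rank; [exact/u_psd/ltnW | exact: u_psd | exact: strict].
  by have := leq_trans (rank_ge _ (leqnn _)) (rank_leq_row _); rewrite ltnn.
have a_dim : \dim <<a>> = m by rewrite (eqnP a_free) size_tuple.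
rewrite /sdp_length; case: ifP => b_a.
  have : (\dim <<a>> <= \dim <<b :: a>>)%N by rewrite span_cons dimvS ?addvSr.
  by rewrite a_dim => dim_ba; case: (leqP n); [right | left; lia].
have : free (b :: a) by rewrite free_cons b_a a_free.
move=> /eqnP dim_ba; rewrite dim_ba /= size_tuple in dimL.
by case: (leqP n); [right | left; lia].
Qed.

(** Forwards, [psd_dual_split] is applied to [v'] itself, whose psd part vanishes by orthogonality
    to the face. *)
Lemma psd_dual_pairP u u' v' : psdmx u ->
  dual_pair ip K S u u' v' <-> psdmx u' /\ exists w beta,
    psdmx (block_mx u w w^T beta%:M) /\ v' = w + w^T.
Proof.
move=> upsd; split.
  move=> [/[!mem_symv]/eqP u'sym /(dual_psd u'sym) u'psd /eqP v'sym v'E].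
  split=> //; have [p [w [beta [_ v'_eq bpsd /(_ v'E) p0]]]] :=
    psd_dual_split upsd v'sym (orth_dual v'E).
  by exists w, beta; split=> //; rewrite v'_eq p0 add0r.
move=> [u'psd [w [beta [bpsd ->]]]]; have u'sym := u'psd.1.
split; [by rewrite mem_symv u'sym | exact/dual_psd | | exact: block_psd_orth bpsd].
by rewrite mem_symv linearD /= trmxK addrC.
Qed.

Lemma sdp_dual_split u y : u \in S -> dual_cone ip K u -> y \in S ->
  dual_cone ip (expface ip K u) y ->
  exists u' v', y = u' + v' /\ dual_pair ip K S u u' v'.
Proof.
rewrite !mem_symv => /eqP usym /(dual_psd usym) upsd /eqP ysym.
move=> /(psd_dual_split upsd ysym)[p [w [beta [ppsd y_eq bpsd _]]]].
exists p, (w + w^T); split=> //; apply/psd_dual_pairP => //.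
by split=> //; exists w, beta.
Qed.

Lemma sdp_ext_dual_valuesE (c : 'rV[R]_m) ell : sdp_ext_dual_values a b c ell =
  [set ip b y | y in [set y | (forall x, ip y (sdp_map a x) = rv_form c x) /\
    exists u v : nat -> 'M[R]_n, [/\ reduction ip K S sdpL ell u v,
      dual_pair ip K S (u ell) (u ell.+1) (v ell.+1)
      & y = u ell.+1 + v ell.+1]]].
Proof.
apply/seteqP; split=> d.
  move=> [u [v [w [beta [[adj_c adj_0 upsd uvw [u0 v0]] ->]]]]].
  exists (u ell.+1 + v ell.+1) => //; split; first exact/sdp_adjP.
  have psd_u i : (i <= ell.+1)%N -> psdmx (u i).
    by case: i => [_|i il]; [rewrite u0; have [] := psd_cone R n | exact: upsd].
  have pair i : (i <= ell)%N -> dual_pair ip K S (u i) (u i.+1) (v i.+1).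
    move=> il; apply/psd_dual_pairP; first exact/psd_u/leqW.
    split; first exact: psd_u.
    by have [bpsd v_eq] := uvw i.+1 il; exists (w i.+1), (beta i.+1).
  exists u, v; split=> //; last exact: pair.
  split=> // i il; have pair_i := pair i (ltnW il); split=> //.
  have [Su _ Sv _] := pair_i; have [adj_i b_i] := adj_0 i.+1 il.
  apply/mem_sdpL; split; [exact: memvD | | by rewrite (ipC ip)].
  by move=> x; rewrite sdp_adjE adj_i /rv_form big1 // => j _; rewrite mxE mul0r.
move=> [y [yc [u [v [[u0 v0 uvP] last_pair y_eq]]]] <-].
have pair i : (i <= ell)%N -> dual_pair ip K S (u i) (u i.+1) (v i.+1).
  by rewrite leq_eqVlt => /predU1P[->//|/uvP[]].
have psd_u i : (i <= ell.+1)%N -> psdmx (u i).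
  case: i => [_|i il]; first by rewrite u0; have [] := psd_cone R n.
  by have [/[!mem_symv]/eqP usym /(dual_psd usym)] := pair i il.
(* [W i] serves step [i + 1], whence the predecessors below; beyond [ell] its value is arbitrary. *)
have /choice[W WP] i : exists W : 'M[R]_n * R, (i <= ell)%N ->
    psdmx (block_mx (u i) W.1 W.1^T W.2%:M) /\ v i.+1 = W.1 + W.1^T.
  have [il|_] := leqP i ell; last by exists (0, 0).
  have /(psd_dual_pairP _ _ (psd_u i (leqW il)))[_ [w [beta wP]]] := pair i il.
  by exists (w, beta).
exists u, v, (fun i => (W i.-1).1), (fun i => (W i.-1).2).
split; last by rewrite -y_eq.
split=> // [|i|i /andP[_ il]|[|i] // il]; [| | exact: psd_u | exact: WP].
  by apply/sdp_adjP => x; rewrite -y_eq.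
case: i => [//|i] /= il; have [_ /mem_sdpL[_ uvA uvb]] := uvP i il; split.
  by apply/sdp_adjP => x; rewrite uvA /rv_form big1 // => j _; rewrite mxE mul0r.
by move: uvb; rewrite (ipC ip).
Qed.

Theorem sdp_extended_dual (c : 'rV[R]_m) : free a -> sdp_feasible a b !=set0 ->
  strong_duality (sdp_primal_values a b c)
                 (sdp_ext_dual_values a b c (sdp_length a b)).
Proof.
move=> a_free [x0 Kx0]; set ell := sdp_length a b.
have Kcc := psd_cone R n.
have [u [v [red Su uK [x1 core_x1]]]] := facial_reduction Kcc sym_proj mem_sdpL
  sdp_dual_split (sdp_length_bound a_free) Kx0.
have slackE x : K (b - sdp_map a x) -> expface ip K (u ell) (b - sdp_map a x).
  by move=> Kx; exact: (reduction_slack mem_sdpL red Kx).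
have := core_strong_duality sym_proj Kx0 (rv_form c) (expface_cone ip (u ell) Kcc)
  (@expface_sub _ _ _ _ _) core_x1 slackE.
congr strong_duality; rewrite sdp_ext_dual_valuesE.
have dualE := dual_expfaceE mem_sdpL sdp_dual_split Su uK
  (ex_intro _ u (ex_intro _ v (conj red erefl))) (ex_intro _ x1 core_x1).
apply/seteqP; split=> d [y].
  by move=> [Sy yE yc] <-; exists y => //; split=> //; apply/dualE.
by move=> [yc /dualE[Sy yE]] <-; exists y.
Qed.

End SdpDuality.

Theorem corollary2 (R : realType) :
  (forall (X Y : vectType R)
      (ipX : {dot X for idfun}) (ipY : {dot Y for idfun})
      (A : 'Hom(X, Y)) (As : 'Hom(Y, X)) (b : Y) (c : X)
      (K F : set Y) (lK : nat),
    is_adjoint ipX ipY A As ->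
    nice ipY K ->
    primal_feasible A b K !=set0 ->
    minimal_cone ipX ipY A b K F ->
    longest_face_chain K lK ->
    let L := Lspace ipY As b in
    let ell := minn (lK - 1) (\dim L) in
    dual_cone ipY F =
      [set y | exists u v : nat -> Y,
        ext_nice_simple ipY K L ell u v /\ y = u ell.+1 + v ell.+1] /\
    strong_duality (primal_values ipX A b c K)
                   (ext_dual_values ipY As b c K L ell))
  /\
  (forall (n m : nat) (a : m.-tuple 'M[R]_n) (b : 'M[R]_n) (c : 'rV[R]_m),
    (forall i, (tnth a i)^T = tnth a i) ->
    b^T = b ->
    free a ->
    sdp_feasible a b !=set0 ->
    strong_duality (sdp_primal_values a b c)
                   (sdp_ext_dual_values a b c (sdp_length a b))).
Proof.
split=> [X Y ipX ipY A As b c K F lK A_adj K_nice feas F_min chain L ell|].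
  exact: nice_extended_dual.
by move=> n m a b c a_sym b_sym; exact: sdp_extended_dual.
Qed.
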